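(* Let $d\ge6$. Then there exists a degree $d$ surface in $\mathbb{P}^3$ belonging to $\left(\overline{F(2,2;3)}\setminus F(2,2;3)\right)\cap F(1,4;3)$.
   Context: Work over $\mathbb{C}$. For positive integers $i_1,\dots,i_k<d$, $F(i_1,\dots,i_k;n)\subseteq|\mathcal{O}_{\mathbb{P}^n}(d)|$ is the set of degree $d$ hypersurfaces $\{f=0\}$ of $\mathbb{P}^n$ whose equation can be written $f=\sum_{h=1}^k f_hg_h$ with $f_h,g_h$ homogeneous, $\deg f_h=i_h$, $\deg g_h=d-i_h$, and $f_1,\dots,f_k$ a regular sequence (i.e. $\{f_1=\cdots=f_k=0\}$ is a complete intersection of dimension $n-k$). $\overline{F(i_1,\dots,i_k;n)}$ denotes the Zariski closure in $|\mathcal{O}_{\mathbb{P}^n}(d)|$. *)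

(* Defs.v *)
From HB Require Import structures.
From mathcomp Require Import all_boot all_order all_algebra.
From mathcomp Require Import mpoly.
From mathcomp Require Import complex.
From mathcomp Require Export reals.

Set Implicit Arguments.
Unset Strict Implicit.
Unset Printing Implicit Defensive.

Import Order.TTheory GRing.Theory Num.Theory.
Local Open Scope ring_scope.

(* Complex numbers: C = R[i] for a realType R (every realType is isomorphic
   to the classical reals, so R[i] is (isomorphic to) the field C). *)

Definition in_ideal (n : nat) (K : comNzRingType) (fs : seq {mpoly K[n]})
    (g : {mpoly K[n]}) : Prop :=
  exists hs : seq {mpoly K[n]},
    g = \sum_(j < size fs) hs`_j * fs`_j.

Definition regular_seq (n : nat) (K : comNzRingType) (fs : seq {mpoly K[n]}) : Prop :=
  ~ in_ideal fs 1 /\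
  forall j : nat, (j < size fs)%N ->
    forall g : {mpoly K[n]},
      in_ideal (take j fs) (fs`_j * g) -> in_ideal (take j fs) g.

(* F(i_1,...,i_k; n) in |O_{P^n}(d)|, described through representatives:
   a nonzero form f of degree d in x_0..x_n with f = sum_h f_h g_h,
   deg f_h = i_h, deg g_h = d - i_h, (f_1,...,f_k) a regular sequence. *)
Definition Fset (K : comNzRingType) (n d : nat) (degs : seq nat)
    (f : {mpoly K[n.+1]}) : Prop :=
  f != 0 /\ f \is d.-homog /\
  exists fs gs : seq {mpoly K[n.+1]},
    [/\ size fs = size degs, size gs = size degs,
        (forall h : nat, (h < size degs)%N ->
           fs`_h \is (nth 0%N degs h).-homog /\ gs`_h \is (d - nth 0%N degs h)%N.-homog),
        f = \sum_(h < size degs) fs`_h * gs`_h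
      & regular_seq fs].

(* Monomials of degree d in n+1 variables: coordinates on the space of
   degree d forms, i.e. homogeneous coordinates on |O_{P^n}(d)|. *)
Definition dmonom (n d : nat) := {m : 'X_{1..n.+1 < d.+1} | mdeg m == d}.

Definition coords (K : comNzRingType) (n d : nat) (f : {mpoly K[n.+1]})
    : 'I_#|{: dmonom n d}| -> K :=
  fun i => f@_(val (val (enum_val i))).
Arguments coords {K} n d f i.

(* Zariski closure in the projective space |O_{P^n}(d)|: the nonzero form f
   (a point of |O(d)|) lies in the closure of S iff every homogeneous
   polynomial G in the coefficients vanishing on (all representatives of) S
   vanishes at f. *)
Definition zariski_closure (K : comNzRingType) (n d : nat)
    (S : {mpoly K[n.+1]} -> Prop) (f : {mpoly K[n.+1]}) : Prop :=
  f != 0 /\ f \is d.-homog /\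
  forall (e : nat) (G : {mpoly K[#|{: dmonom n d}|]}),
    G \is e.-homog ->
    (forall g, S g -> meval (coords n d g) G = 0) ->
    meval (coords n d f) G = 0.

Arguments Fset {K} n d degs f.
Arguments zariski_closure {K} n d S f.

(* Main.v *)
Require Import Defs.
From HB Require Import structures.
From mathcomp Require Import all_boot all_order all_algebra.
From mathcomp Require Import mpoly complex.
From mathcomp Require Import zify ring.
Set Implicit Arguments.
Unset Strict Implicit.
Unset Printing Implicit Defensive.
Import Order.TTheory GRing.Theory Num.Theory.
Local Open Scope ring_scope.

(* Take f = w f', where w is a coordinate and f' is a form of degree d - 1 >= 5 in the
   ideal (w, x, y^2); then f lies in (w, y^4) trivially.  Writing f' = w a + x b + y^2 e,
   the form f + t y^2 b lies in (w^2, w x + t y^2) for t <> 0, so f is in the closure of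
   F(2,2;3).  If f itself were in (q1, q2), then removing the plane w = 0 from the curve
   q1 = q2 = 0 would leave a complete intersection of two quadrics, a conic, or a curve
   cut out by the 2x2 minors of [[b1, b2, -w], [c1, c2, a]], and f' would vanish on it.
   Forms of degree >= 5 vanishing on such a curve depend on fewer parameters than the
   forms in (w, x, y^2), so a general f' avoids all of them.  The dimension count rests on
   algebraic dependence: N polynomials in fewer than N parameters satisfy a nontrivial
   polynomial relation, hence the bad forms lie in a hypersurface. *)

(** * Algebraic dependence *)

(** All three counts are tight. The ideal (w, x, y^2) defines a point with a tangent direction, so
    it costs 2 conditions, and for D = d - 1 the inequalities are 17 < 4D - 2, 8 < 2D - 1 and 13 <
    3D - 1. At D = 5 each holds with a margin of one and at D = 4 each fails: this is how d >= 6
    enters, and why the generators are brought to normal forms with 3, 6 and 7 coefficients fixed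
    before anything is counted. Hilbert functions of the bad curves are never computed. A count
    needs only an upper bound for the degree D part of an ideal, and independent syzygies between
    explicit generators give one. Such syzygies stay independent when the curve degenerates, so
    singular, reducible and nonreduced curves need no separate treatment. *)

Lemma row_kernel_neq0 (K : fieldType) m p (A : 'M[K]_(m, p)) :
  (p < m)%N -> exists2 c : 'rV[K]_m, c != 0 & c *m A = 0.
Proof.
move=> ltpm; have /rowV0Pn[c cK c0] : kermx A != 0.
  by rewrite -mxrank_eq0 mxrank_ker -lt0n subn_gt0 (leq_ltn_trans (rank_leq_col A)).
by exists c => //; apply/sub_kermxP.
Qed.

Lemma card_bmultinom_le a E : (#|{: 'X_{1..a < E}}| <= E ^ a)%N.
Proof.
case: E => [|E].
  by rewrite eq_card0 // => m; have := bmdeg m.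
pose f (m : 'X_{1..a < E.+1}) : {ffun 'I_a -> 'I_E.+1} := [ffun i => inord (bmnm m i)].
have f_inj : injective f.
  move=> m1 m2 /ffunP eqf; apply/val_inj/mnmP => i.
  have lti (m : 'X_{1..a < E.+1}) : (bmnm m i < E.+1)%N.
    by rewrite (leq_ltn_trans _ (bmdeg m)) // mdegE (bigD1 i) //= leq_addr.
  by have := congr1 val (eqf i); rewrite !ffunE /= !inordK.
by rewrite (leq_trans (leq_card f f_inj)) // card_ffun !card_ord.
Qed.

Lemma msizeM_le_pred (K : idomainType) a (p q : {mpoly K[a]}) :
  (msize (p * q) <= (msize p + msize q).-1)%N.
Proof.
have [->|p0] := eqVneq p 0; first by rewrite mul0r msize0.
have [->|q0] := eqVneq q 0; first by rewrite mulr0 msize0.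
by rewrite msizeM.
Qed.

(* Monomials of degree < D in each of N quantities outnumber the monomials in
   a < N variables that can occur in their expansions, once D is large. *)
Lemma algebraic_dependence (K : fieldType) a N (phi : 'I_N -> {mpoly K[a]}) :
  (a < N)%N ->
  exists2 G : {mpoly K[N]}, G != 0 &
    forall th, G.@[fun i => (phi i).@[th]] = 0.
Proof.
move=> ltaN.
pose e := (\max_i msize (phi i))%N.
(* [D] exceeds (N e + 1)^a, so (D (N e + 1))^a < D^(a+1) <= D^N. The left side bounds the number of
   monomials of degree below [E], the right side counts the products of powers of the [phi i]. *)
pose D := ((N * e).+1 ^ a).+1.
pose E := (N * (D * e)).+1.
pose T := {ffun 'I_N -> 'I_D}.
pose mon (g : T) : 'X_{1..N} := [multinom (g i : nat) | i < N].
have mon_inj : injective mon.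
  by move=> g h /mnmP eqm; apply/ffunP => i; apply: val_inj; have := eqm i; rewrite !mnmE.
pose lp := [tuple phi i | i < N].
pose F (g : T) : {mpoly K[a]} := 'X_[mon g] \mPo lp.
have sizeF g : (msize (F g) <= E)%N.
  have sizeX p k : (msize (p ^+ k : {mpoly K[a]}) <= (k * msize p).+1)%N.
    elim: k => [|k IH]; first by rewrite expr0 msize1.
    rewrite exprS; move: IH (msizeM_le_pred p (p ^+ k)).
    rewrite mulSn; move: (msize (p * _)) (msize (p ^+ k)) (msize p) => u v t; lia.
  have sizeprod (I : Type) (r : seq I) (H : I -> {mpoly K[a]}) :
      (msize (\prod_(i <- r) H i) <= (\sum_(i <- r) (msize (H i)).-1).+1)%N.
    elim: r => [|i r IH]; first by rewrite !big_nil msize1.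
    rewrite !big_cons; move: IH (msizeM_le_pred (H i) (\prod_(j <- r) H j)).
    move: (msize (H i * _)) (\sum_(j <- r) _)%N (msize (\prod_(j <- r) _)) (msize (H i)) => u s v t.
    lia.
  rewrite /F comp_mpolyX (leq_trans (sizeprod _ _ _)) // ltnS.
  apply: (@leq_trans (\sum_(i < N) D * e)); last by rewrite sum_nat_const card_ord.
  apply: leq_sum => i _; rewrite mnmE tnth_mktuple.
  apply: (@leq_trans (g i * msize (phi i))%N).
    by have := sizeX (phi i) (g i); case: (msize _).
  by apply: leq_mul; [apply/ltnW/ltn_ord | apply: (leq_bigmax i)].
pose A : 'M[K]_(#|T|, #|{: 'X_{1..a < E}}|) :=
  \matrix_(i, j) (F (enum_val i))@_(bmnm (enum_val j)).
have [|c c0 cA] := @row_kernel_neq0 _ _ _ A.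
  apply: leq_ltn_trans (card_bmultinom_le _ _) _.
  rewrite card_ffun !card_ord.
  have leE : (E <= D * (N * e).+1)%N by rewrite /E /D; lia.
  apply: (@leq_ltn_trans ((D * (N * e).+1) ^ a)%N).
    by case: (posnP a) => [->|a0]; [rewrite !expn0 | rewrite leq_exp2r].
  apply: (@leq_trans (D ^ a.+1)%N); last by rewrite leq_exp2l // ltnS expn_gt0.
  by rewrite expnMn expnSr ltn_pmul2l ?expn_gt0 // /D ltnS.
exists (\sum_(i < #|T|) c 0 i *: 'X_[mon (enum_val i)]).
  apply: contraNneq c0 => G0; apply/eqP/rowP => i; rewrite mxE.
  have := congr1 (mcoeff (mon (enum_val i))) G0.
  rewrite mcoeff0 raddf_sum /= (bigD1 i) //= big1 ?addr0.
    by rewrite mcoeffZ mcoeffX eqxx mulr1.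
  move=> j neji; rewrite mcoeffZ mcoeffX (inj_eq mon_inj) (inj_eq enum_val_inj).
  by rewrite (negPf neji) mulr0.
move=> th.
have F0 : \sum_(i < #|T|) c 0 i *: F (enum_val i) = 0.
  apply/mpolyP => m; rewrite mcoeff0 raddf_sum /=.
  have [ltm|lem] := ltnP (mdeg m) E.
    have := congr1 (fun B : 'rV_(_) => B 0 (enum_rank (BMultinom ltm))) cA.
    rewrite mxE [RHS]mxE; apply: etrans; apply: eq_bigr => i _.
    by rewrite mxE enum_rankK mcoeffZ.
  rewrite big1 // => i _; rewrite mcoeffZ [X in _ * X]memN_msupp_eq0 ?mulr0 //.
  by rewrite msize_mdeg_ge // (leq_trans (sizeF _)).
have := congr1 (meval th) F0; rewrite meval0 => <-.
rewrite !raddf_sum /=; apply: eq_bigr => i _.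
rewrite !mevalZ comp_mpoly_meval; congr (_ * _); apply: meval_eq => j.
by rewrite tnth_mktuple.
Qed.

(** * Thin sets of coefficient vectors *)

(** A monomial is determined by its exponent in the last variable together with the remaining
    exponents, so the leading term of [p] cannot cancel inside [muni p]. *)
Lemma muni_neq0 (K : comNzRingType) n (p : {mpoly K[n.+1]}) : p != 0 -> muni p != 0.
Proof.
move=> p0; have := mlead_supp p0; set m0 := mlead p => m0p.
pose res (m : 'X_{1..n.+1}) := [multinom m (widen_ord (leqnSn n) i) | i < n].
have resE m : res m = res m0 -> m ord_max = m0 ord_max -> m = m0.
  move=> eqr eqm; apply/mnmP => i; have [j ->|->] := unliftP ord_max i => //.
  have -> : lift ord_max j = widen_ord (leqnSn n) j.
    by apply: val_inj; rewrite /= /bump leqNgt ltn_ord.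
  by have /mnmP/(_ j) := eqr; rewrite !mnmE.
suff : (muni p)`_(m0 ord_max)@_(res m0) != 0.
  by apply: contraNneq => ->; rewrite coef0 mcoeff0.
rewrite muniE coef_sum raddf_sum /= (bigD1_seq m0) ?msupp_uniq //= big1 ?addr0.
  by rewrite coefZ coefXn eqxx mulr1 mcoeffZ mcoeffX eqxx mulr1 -mcoeff_msupp.
move=> m ne; rewrite coefZ coefXn; have [eqm|] := eqVneq; last by rewrite mulr0 mcoeff0.
rewrite mulr1 mcoeffZ mcoeffX; have [eqr|] := eqVneq; last by rewrite mulr0.
by case/eqP: ne; apply: resE.
Qed.

Lemma horner_muni (K : comNzRingType) n (p : {mpoly K[n.+1]}) (v : 'I_n -> K) t :
  (map_poly (meval v) (muni p)).[t] =
    p.@[fun i => if unlift ord_max i is Some j then v j else t].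
Proof.
rewrite muniE rmorph_sum horner_sum [X in _ = _ X]mpolyE raddf_sum /=.
apply: eq_bigr => m _.
rewrite map_polyZ /= map_polyXn hornerZ hornerXn mevalZ mevalX mevalZ mevalX.
rewrite big_ord_recr /= unlift_none -mulrA; congr (_ * (_ * _)).
apply: eq_bigr => i _; rewrite mnmE.
have -> : widen_ord (leqnSn n) i = lift ord_max i.
  by apply: val_inj; rewrite /= /bump leqNgt ltn_ord.
by rewrite liftK.
Qed.

(** In characteristic 0 the integers below [size p] are distinct, too many to be roots of [p]. *)
Lemma poly_nonroot (K : numDomainType) (p : {poly K}) : p != 0 -> exists t, p.[t] != 0.
Proof.
move=> p0; pose s := [seq (i%:R : K) | i <- iota 0 (size p)].
have [/allP rs|] := boolP (all (root p) s); last first.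
  by case/allPn => t _ rt; exists t.
have us : uniq s by rewrite map_inj_uniq ?iota_uniq // => i j /eqP; rewrite eqr_nat => /eqP.
by have := max_poly_roots p0 (introT allP rs) us; rewrite size_map size_iota ltnn.
Qed.

Lemma mpoly_nonroot (K : numDomainType) n (p : {mpoly K[n]}) :
  p != 0 -> exists v, p.@[v] != 0.
Proof.
elim: n p => [|n IH] p p0.
  exists (fun _ => 0); move: p0; rewrite (nvar0_mpolyC p) mpolyC_eq0.
  by rewrite mevalC.
have mp0 := muni_neq0 p0.
have [v vP] : exists v, map_poly (meval v) (muni p) != 0.
  have [|v vP] := IH (lead_coef (muni p)); first by rewrite lead_coef_eq0.
  exists v; apply: contraNneq vP => /(congr1 (fun q : {poly K} => q`_(size (muni p)).-1)).
  by rewrite coef_map coef0 => /= ->.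
have [t tP] := poly_nonroot vP.
by exists (fun i => if unlift ord_max i is Some j then v j else t); rewrite -horner_muni.
Qed.

Section Thin.
Variable (K : numFieldType).

(** Stands in for positive codimension in the coefficient space: one nonzero equation is enough,
    finite unions multiply equations, and no dimension theory is involved. *)
Definition thin (C : finType) (X : (C -> K) -> Prop) : Prop :=
  exists2 G : {mpoly K[#|C|]}, G != 0 & forall v, X v -> G.@[v \o enum_val] = 0.

Lemma thin_proper (C : finType) (X : (C -> K) -> Prop) : thin X -> exists v, ~ X v.
Proof.
case=> G /mpoly_nonroot[v vP] GX; exists (v \o enum_rank) => /GX/eqP; apply/negP.
by apply: contraNneq vP => <-; apply/eqP/meval_eq => i; rewrite /= enum_valK.
Qed.

Lemma thin_sub (C : finType) (X Y : (C -> K) -> Prop) :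
  (forall v, X v -> Y v) -> thin Y -> thin X.
Proof. by move=> sXY [G G0 GY]; exists G => // v /sXY; apply: GY. Qed.

Lemma thin_bigU (C I : finType) (X : I -> (C -> K) -> Prop) :
  (forall i, thin (X i)) -> thin (fun v => exists i, X i v).
Proof.
move=> /fin_all_exists2[G G0 GX]; exists (\prod_i G i); first exact/prodf_neq0.
by move=> v [i /GX G0i]; rewrite rmorph_prod (bigD1 i) //= G0i mul0r.
Qed.

Lemma thinU (C : finType) (X Y : (C -> K) -> Prop) :
  thin X -> thin Y -> thin (fun v => X v \/ Y v).
Proof.
move=> tX tY; apply: thin_sub (_ : thin (fun v => exists b : bool, (if b then X else Y) v)).
  by move=> v [] ?; [exists true | exists false].
by apply: thin_bigU => -[].
Qed.

Definition spec (P : finType) (th : P -> K) (p : {mpoly K[#|P|]}) : K :=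
  p.@[th \o enum_val].

Lemma thin_image (P C : finType) (phi : C -> {mpoly K[#|P|]}) :
  (#|P| < #|C|)%N -> thin (fun v => exists th, v =1 fun k => spec th (phi k)).
Proof.
move=> /(algebraic_dependence (phi \o enum_val))[G G0 GX].
exists G => // v [th vE]; rewrite -[RHS](GX (th \o enum_val)).
by apply: meval_eq => i /=; rewrite vE.
Qed.

(** A dimension count for a varying vector space: [#|P| - #|J|] free parameters plus at most [r]
    coefficients on a maximal independent set of rows. Which rows are independent depends on [th],
    but there are finitely many choices, and each choice gives the image of a polynomial map in
    those parameters. *)
Lemma thin_span (P I C : finType) (M : I -> C -> {mpoly K[#|P|]})
    (J : {set P}) (e : P -> K) r :
  (#|P| - #|J| + r < #|C|)%N ->
  thin (fun v => exists th : P -> K,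
    [/\ forall j, j \in J -> th j = e j,
        (\rank (\matrix_(i < #|I|, k < #|C|) spec th (M (enum_val i) (enum_val k)))
           <= r)%N
      & exists c : I -> K, forall k, v k = \sum_i c i * spec th (M i k)]).
Proof.
move=> lt_C; pose T := {p : P | p \notin J}.
have cardT : #|{: T}| = (#|P| - #|J|)%N.
  by rewrite card_sig -(cardC (mem J)) addKn; apply: eq_card.
pose S (s : 'I_r.+1) := (T + 'I_s)%type.
(* Parameters in [J] become the constants [e p]; the others stay variables, next to [s] new ones for
   the coefficients of the combination. *)
pose V s (p : P) : {mpoly K[#|{: S s}|]} :=
  if insub p is Some u then 'X_(enum_rank (inl u : S s)) else (e p)%:MP.
pose phi (x : {s : 'I_r.+1 & {ffun 'I_s -> I}}) k : {mpoly K[#|{: S (tag x)}|]} :=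
  \sum_(j < tag x) 'X_(enum_rank (inr j : S (tag x))) *
     (M (tagged x j) k \mPo [tuple V (tag x) (enum_val i) | i < #|P|]).
have phi_thin x : thin (fun v => exists th, v =1 fun k => spec th (phi x k)).
  apply: thin_image; rewrite card_sum cardT card_ord.
  by apply: leq_ltn_trans lt_C; rewrite leq_add2l -ltnS.
apply: thin_sub (thin_bigU phi_thin) => v [th [thJ]].
set A := \matrix_(_, _) _ => rA [c vE].
have [D DE] : exists D, \row_k v (enum_val k) = D *m rowsub (maxrankfun A) A.
  apply/submxP; rewrite eq_maxrowsub; apply/submxP.
  exists (\row_i c (enum_val i)); apply/rowP => k; rewrite !mxE vE.
  rewrite (reindex _ (onW_bij _ (enum_val_bij _))) /=.
  by apply: eq_bigr => i _; rewrite !mxE.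
have lt_r : (\rank A < r.+1)%N by rewrite ltnS.
pose s : 'I_r.+1 := Ordinal lt_r.
exists (Tagged (fun s : 'I_r.+1 => {ffun 'I_s -> I})
   ([ffun j => enum_val (maxrankfun A j)] : {ffun 'I_s -> I})).
exists (fun x : S s => match x with inl u => th (val u) | inr j => D 0 j end) => k.
have := congr1 (fun B : 'rV_(_) => B 0 (enum_rank k)) DE.
rewrite !mxE enum_rankK => ->; rewrite /phi /= /spec raddf_sum /=.
apply: eq_bigr => j _; rewrite mevalM mevalXU /= enum_rankK; congr (_ * _).
rewrite !mxE ffunE enum_rankK /spec comp_mpoly_meval.
apply: meval_eq => i; rewrite tnth_mktuple /V /=.
case: insubP => [u _ <-|]; first by rewrite mevalXU /= enum_rankK.
by rewrite negbK => /thJ ->; rewrite mevalC.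
Qed.
End Thin.

(** * Graded pieces of ideals *)

Lemma sum_enum_val (V : nmodType) (T : finType) (F : T -> V) :
  \sum_(x < #|T|) F (enum_val x) = \sum_x F x.
Proof. by rewrite [RHS](reindex _ (onW_bij _ (enum_val_bij _))). Qed.

Section Monomials.
Variables (n : nat) (K : fieldType).
Implicit Types (p q g : {mpoly K[n.+1]}).

Definition mon k (u : dmonom n k) : 'X_{1..n.+1} := bmnm (val (val u)).

Lemma mon_inj k : injective (@mon k).
Proof. by move=> u v eq_uv; do 2!apply: val_inj. Qed.

Lemma mdeg_mon k (u : dmonom n k) : mdeg (mon u) = k.
Proof. exact/eqP/(valP u). Qed.

Lemma monP k (m : 'X_{1..n.+1}) : mdeg m = k -> exists u : dmonom n k, mon u = m.
Proof.
move=> mk; have lt_m : (mdeg m < k.+1)%N by rewrite mk.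
have dm : mdeg (BMultinom lt_m) == k by apply/eqP.
by exists (exist _ (BMultinom lt_m) dm).
Qed.

Lemma homogX_mon k (u : dmonom n k) : ('X_[mon u] : {mpoly K[n.+1]}) \is k.-homog.
Proof. by rewrite dhomogX; apply/eqP/mdeg_mon. Qed.

Lemma card_dmonom k : #|{: dmonom n k}| = 'C(k + n, k).
Proof.
rewrite -size_basis cardE -(size_map (@mon k)); apply/perm_size/uniq_perm; last 1 first.
- move=> m; rewrite -basis_cover; apply/mapP/eqP => [[u _ ->]|/monP[u <-]].
    exact: mdeg_mon.
  by exists u; rewrite ?mem_enum.
- by rewrite map_inj_uniq ?enum_uniq //; apply: mon_inj.
- exact: uniq_basis.
Qed.

Lemma mcoeff_sum_mon k (c : dmonom n k -> K) u :
  (\sum_w c w *: 'X_[mon w])@_(mon u) = c u.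
Proof.
rewrite raddf_sum (bigD1 u) //= big1 ?addr0 => [|w ne].
  by rewrite mcoeffZ mcoeffX eqxx mulr1.
by rewrite mcoeffZ mcoeffX (inj_eq (@mon_inj k)) (negPf ne) mulr0.
Qed.

Lemma homog_sum_mon k p : p \is k.-homog -> p = \sum_(u : dmonom n k) p@_(mon u) *: 'X_[mon u].
Proof.
move=> hp; apply/mpolyP => m; have [/monP[u <-]|ne] := eqVneq (mdeg m) k.
  by rewrite (mcoeff_sum_mon (fun u => p@_(mon u))).
rewrite (dhomog_nemf_coeff hp ne) raddf_sum big1 //= => u _.
rewrite mcoeffZ mcoeffX; case: eqP => [um|]; last by rewrite mulr0.
by rewrite -um mdeg_mon eqxx in ne.
Qed.

(** The cofactors in an ideal membership are arbitrary polynomials; this cuts them down to their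
    component of complementary degree, which makes membership of a form a question of linear
    algebra. *)
Lemma pihomogM e D p g : p \is e.-homog -> (e <= D)%N ->
  pihomog mdeg D (p * g) = p * pihomog mdeg (D - e) g.
Proof.
move=> hp leD; set s := (msize g + D).+1.
have leg : (msize g <= s)%N by rewrite /s; lia.
rewrite {1}(pihomog_partitionE leg) mulr_sumr raddf_sum /=.
have ltD : (D - e < s)%N by rewrite /s; lia.
rewrite (bigD1 (Ordinal ltD)) //= big1 ?addr0.
  by rewrite pihomog_dE // -{2}(subnKC leD) dhomogM // pihomogP.
move=> d ne; apply: (@pihomog_ne0 _ _ _ (e + d)).
  by apply: contra_neq ne => eqD; apply: val_inj; rewrite /= -eqD addKn.
by rewrite dhomogM // pihomogP.
Qed.

Section RankBound.
Variables (I J C : finType) (D : nat) (p : I -> {mpoly K[n.+1]}) (e : I -> nat).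
Variables (t : J -> nat) (Z : J -> I -> {mpoly K[n.+1]}) (col : C -> 'X_{1..n.+1}).
Hypotheses (le_et : forall i j, (e i <= t j <= D)%N).
Hypotheses (hZ : forall j i, Z j i \is (t j - e i)%N.-homog).
Hypotheses (ZP : forall j, \sum_i Z j i * p i = 0).
Hypotheses (Z_inj : forall u : J -> {mpoly K[n.+1]},
  (forall i, \sum_j u j * Z j i = 0) -> forall j, u j = 0).

Let rowT := {i : I & dmonom n (D - e i)}.
Let syzT := {j : J & dmonom n (D - t j)}.

(** A Macaulay matrix: for [p i] homogeneous of degree [e i], its rows span the degree [D] part of
    the ideal of the [p i], seen through the coefficients selected by [col]. *)
Definition ideal_mx : 'M[K]_(#|{: rowT}|, #|C|) :=
  \matrix_(x, k) (p (tag (enum_val x)) * 'X_[mon (tagged (enum_val x))])@_(col (enum_val k)).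

Lemma sum_rowT (F : forall i, dmonom n (D - e i) -> {mpoly K[n.+1]}) :
  \sum_(x < #|{: rowT}|) F (tag (enum_val x)) (tagged (enum_val x)) = \sum_i \sum_u F i u.
Proof.
rewrite (sum_enum_val (fun x : rowT => F (tag x) (tagged x))).
by rewrite [RHS]sig_big_dep.
Qed.

Lemma card_sigT_dmonom (L : finType) (d : L -> nat) :
  #|{: {l : L & dmonom n (d l)}}| = (\sum_l 'C(d l + n, d l))%N.
Proof.
rewrite card_tagged sumnE big_map big_enum /=.
by apply: eq_bigr => l _; rewrite card_dmonom.
Qed.

(* The rows of Z are independent syzygies of the generators; each lowers the rank. *)
Lemma rank_ideal_mx :
  (\rank ideal_mx <= \sum_i 'C(D - e i + n, D - e i) - \sum_j 'C(D - t j + n, D - t j))%N.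
Proof.
(* The monomial multiples of the syzygies, written in the row index of the Macaulay matrix. They lie
   in its left kernel, so once [B] is row free its number of rows is subtracted from the rank. *)
pose B : 'M[K]_(#|{: syzT}|, #|{: rowT}|) :=
  \matrix_(y, x) (Z (tag (enum_val y)) (tag (enum_val x)) * 'X_[mon (tagged (enum_val y))])
     @_(mon (tagged (enum_val x))).
have hZX j (u : dmonom n (D - t j)) i : Z j i * 'X_[mon u] \is (D - e i).-homog.
  have -> : (D - e i = t j - e i + (D - t j))%N by have := le_et i j; lia.
  by rewrite dhomogM // homogX_mon.
have BA : B *m ideal_mx = 0.
  apply/matrixP => y k; rewrite !mxE.
  under eq_bigr => x _ do rewrite !mxE -mcoeffZ scalerAr.
  rewrite -raddf_sum /=; case: (enum_val y) => j u /=.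
  rewrite (sum_rowT (fun i m => p i * ((Z j i * 'X_[mon u])@_(mon m) *: 'X_[mon m]))).
  under eq_bigr => i _ do rewrite -mulr_sumr -homog_sum_mon // mulrA [p i * _]mulrC.
  by rewrite -mulr_suml ZP mul0r mcoeff0.
have Bfree : row_free B.
  rewrite -kermx_eq0; apply/rowV0P => c /sub_kermxP cB.
  pose U j := \sum_(u : dmonom n (D - t j))
    c 0 (enum_rank (Tagged (fun j => dmonom n (D - t j)) u)) *: 'X_[mon u].
  have U0 : forall j, U j = 0.
    apply: Z_inj => i; rewrite (@homog_sum_mon (D - e i) (\sum_j _)).
      rewrite big1 // => m _.
      have := congr1 (fun M : 'rV_(_) => M 0 (enum_rank (Tagged (fun i => dmonom n (D - e i)) m))) cB.
      rewrite !mxE => cB0; apply/eqP; rewrite scaler_eq0; apply/orP; left; apply/eqP.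
      rewrite -[RHS]cB0 raddf_sum /=.
      under [RHS]eq_bigr => y _ do rewrite mxE enum_rankK /= -{1}[y]enum_valK.
      rewrite (sum_enum_val (fun y : syzT => c 0 (enum_rank y) *
        (Z (tag y) i * 'X_[mon (tagged y)])@_(mon m))).
      transitivity (\sum_j \sum_(u : dmonom n (D - t j))
          c 0 (enum_rank (Tagged (fun j => dmonom n (D - t j)) u)) *
            (Z j i * 'X_[mon u])@_(mon m)).
        apply: eq_bigr => j _; rewrite mulr_suml raddf_sum /=.
        by apply: eq_bigr => u _; rewrite -scalerAl mcoeffZ [Z j i * _]mulrC.
      by rewrite sig_big_dep; apply: eq_bigr => -[j u].
    apply: rpred_sum => j _; rewrite mulr_suml rpred_sum // => u _.
    by rewrite -scalerAl rpredZ // mulrC.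
  apply/rowP => y; rewrite mxE -[y]enum_valK; case: (enum_val y) => j u.
  have := congr1 (mcoeff (mon u)) (U0 j).
  by rewrite mcoeff0 (mcoeff_sum_mon (fun u => c 0 (enum_rank (Tagged (fun j => dmonom n (D - t j)) u)))).
have le_rank := mulmx0_rank_max BA; rewrite (eqP Bfree) in le_rank.
rewrite -(card_sigT_dmonom (fun i => (D - e i)%N)) -(card_sigT_dmonom (fun j => (D - t j)%N)).
by rewrite -[X in (X <= _)%N](addKn #|{: syzT}|) leq_sub2r.
Qed.
End RankBound.
End Monomials.

(** * Ideals generated by generic forms *)

Section GenericForms.
Variables (n k : nat) (K : numFieldType) (dl : 'I_k -> nat).

Definition coefT := {i : 'I_k & dmonom n (dl i)}.
Definition coefT_of i (u : dmonom n (dl i)) : coefT := Tagged (fun i => dmonom n (dl i)) u.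

Definition coefs_of (F : 'I_k -> {mpoly K[n.+1]}) (x : coefT) : K :=
  (F (tag x))@_(mon (tagged x)).

Definition generic_form (i : 'I_k) : {mpoly {mpoly K[#|{: coefT}|]}[n.+1]} :=
  \sum_(u : dmonom n (dl i)) 'X_(enum_rank (coefT_of u)) *: 'X_[mon u].

Definition specialize F : {mpoly {mpoly K[#|{: coefT}|]}[n.+1]} -> {mpoly K[n.+1]} :=
  locked (map_mpoly (meval (coefs_of F \o enum_val))).

Lemma specializeE F p : specialize F p = map_mpoly (meval (coefs_of F \o enum_val)) p.
Proof. by rewrite /specialize -lock. Qed.

Lemma specialize_generic F i : F i \is (dl i).-homog -> specialize F (generic_form i) = F i.
Proof.
move=> hF; rewrite [RHS](homog_sum_mon hF) specializeE raddf_sum /=.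
apply: eq_bigr => u _; rewrite map_mpolyZ map_mpolyX.
by rewrite /= mevalXU /= enum_rankK.
Qed.

Lemma specializeX F m : specialize F 'X_[m] = 'X_[m].
Proof. by rewrite specializeE; apply: map_mpolyX. Qed.

Lemma specializeM F : {morph specialize F : p q / p * q}.
Proof. by move=> p q; rewrite !specializeE rmorphM. Qed.

Lemma specialize_mulD F p q r s p' q' r' s' :
  specialize F p = p' -> specialize F q = q' -> specialize F r = r' -> specialize F s = s' ->
  specialize F (p * q + r * s) = p' * q' + r' * s'.
Proof. by move=> <- <- <- <-; rewrite !specializeE rmorphD !rmorphM. Qed.

Lemma specialize_mulB F p q r s p' q' r' s' :
  specialize F p = p' -> specialize F q = q' -> specialize F r = r' -> specialize F s = s' ->
  specialize F (p * q - r * s) = p' * q' - r' * s'.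
Proof. by move=> <- <- <- <-; rewrite !specializeE rmorphB !rmorphM. Qed.

(** The common form of the three counts: unfixed coefficients of the forms [F], plus the bound on
    the degree [D] part of the ideal, against the number of coordinates. [S] and [ev] record the
    normalization. The generators are written through generic forms so that the entries of the
    Macaulay matrix are polynomials in the coefficients of [F]. *)
Lemma thin_ideal (I J C : finType) (gens : I -> {mpoly {mpoly K[#|{: coefT}|]}[n.+1]})
    (e : I -> nat) (t : J -> nat) D (col : C -> 'X_{1..n.+1}) (S : {set coefT}) (ev : coefT -> K) :
  (forall i, e i <= D)%N -> (forall i j, e i <= t j <= D)%N ->
  (#|{: coefT}| - #|S| + (\sum_i 'C(D - e i + n, D - e i) - \sum_j 'C(D - t j + n, D - t j))
     < #|C|)%N ->
  thin (fun v => exists F p Z (g : I -> {mpoly K[n.+1]}) f,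
    [/\ [/\ forall i, F i \is (dl i).-homog, {in S, coefs_of F =1 ev},
           forall i, specialize F (gens i) = p i & forall i, p i \is (e i).-homog],
        [/\ forall j i, Z j i \is (t j - e i)%N.-homog, forall j, \sum_i Z j i * p i = 0
          & forall u : J -> {mpoly K[n.+1]},
              (forall i, \sum_j u j * Z j i = 0) -> forall j, u j = 0]
      & [/\ f \is D.-homog, f = \sum_i p i * g i & forall c, v c = f@_(col c)]]).
Proof.
move=> leD le_et ltC.
pose M (x : {i : I & dmonom n (D - e i)}) (c : C) :=
  (gens (tag x) * 'X_[mon (tagged x)])@_(col c).
apply: thin_sub (thin_span M ev ltC) => v [F [p [Z [g [f]]]]].
case=> -[hF FS pE hp] [hZ ZP Z_inj] [hf fE vE].
exists (coefs_of F).
have MP x c : spec (coefs_of F) (M x c) = (p (tag x) * 'X_[mon (tagged x)])@_(col c).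
  by rewrite /spec /M -mcoeff_map_mpoly -specializeE specializeM pE specializeX.
split=> //.
  have := rank_ideal_mx col le_et hZ ZP Z_inj; apply: leq_trans.
  by rewrite [X in (\rank X <= _)%N](_ : _ = ideal_mx D p e col) //; apply/matrixP => x c; rewrite !mxE MP.
exists (fun x : {i : I & dmonom n (D - e i)} =>
  (pihomog mdeg (D - e (tag x)) (g (tag x)))@_(mon (tagged x))) => c.
under eq_bigr => x _ do rewrite MP -mcoeffZ scalerAr.
rewrite -raddf_sum vE /=; congr mcoeff.
transitivity (\sum_i \sum_(u : dmonom n (D - e i))
    p i * ((pihomog mdeg (D - e i) (g i))@_(mon u) *: 'X_[mon u])); last first.
  by rewrite sig_big_dep; apply: eq_bigr => -[j u].
rewrite -(pihomog_dE hf) fE raddf_sum /=; apply: eq_bigr => i _.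
by rewrite (pihomogM _ (hp i)) // -mulr_sumr -homog_sum_mon // pihomogP.
Qed.
End GenericForms.

(** Clears the denominator, so that comparing binomials in r = D - 5 becomes polynomial arithmetic
    within reach of [lia]. *)
Lemma bin3E m : ('C(m + 3, m) * 6 = (m + 1) * (m + 2) * (m + 3))%N.
Proof.
rewrite -bin_sub ?leq_addr // addKn -[6%N]/(3`!) bin_ffact.
by rewrite ffactnS ffactnS ffactn1; lia.
Qed.

Lemma card_coefT n k (dl : 'I_k -> nat) :
  #|{: coefT n dl}| = (\sum_i 'C(dl i + n, dl i))%N.
Proof.
by rewrite card_tagged sumnE big_map big_enum /=; apply: eq_bigr => l _; rewrite card_dmonom.
Qed.

(** * Reduction modulo a linear form *)

Section Substitution.
Variables (n : nat) (K : numFieldType).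
Implicit Types (p q l : {mpoly K[n.+1]}).

Lemma mpoly_ring_ind (P : {mpoly K[n.+1]} -> Prop) :
  (forall c, P c%:MP) -> (forall i, P 'X_i) ->
  (forall p q, P p -> P q -> P (p + q)) -> (forall p q, P p -> P q -> P (p * q)) ->
  forall p, P p.
Proof.
move=> PC PX PD PM; elim/mpolyind => [|c m p _ _ Pp]; first by rewrite -(mpolyC0 _ K).
apply: PD => //; rewrite -mul_mpolyC; apply: (PM) => //.
rewrite mpolyXE_id; apply: (big_ind P) => [|x y|i _].
- by rewrite -(mpolyC1 _ K).
- exact: PM.
move: (fun_of_multinom m i) => k; elim: k => [|k IH]; first by rewrite expr0 -(mpolyC1 _ K).
by rewrite exprS; apply: PM.
Qed.

Lemma dhomog_comp k p (lq : n.+1.-tuple {mpoly K[n.+1]}) :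
  (forall i, tnth lq i \is 1.-homog) -> p \is k.-homog -> p \mPo lq \is k.-homog.
Proof.
move=> hlq /homog_sum_mon ->; rewrite raddf_sum /=.
apply: rpred_sum => u _; rewrite comp_mpolyZ rpredZ // comp_mpolyX.
suff: \prod_i tnth lq i ^+ mon u i \is (\sum_i mon u i)%N.-homog by rewrite -mdegE mdeg_mon.
elim: (index_enum _) => [|i r IH]; first by rewrite !big_nil dhomog1.
by rewrite !big_cons dhomogM //; have := dhomogMn (mon u i) (hlq i); rewrite mul1n.
Qed.

Lemma linear_sumE l : l \is 1.-homog -> l = \sum_i l@_U_(i) *: 'X_i.
Proof.
move=> hl; apply/mpolyP => m; rewrite raddf_sum /=.
have [/eqP/mdeg1P[i /eqP->]|ne] := eqVneq (mdeg m) 1%N.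
  rewrite (bigD1 i) //= big1 ?addr0 => [|j ne]; rewrite mcoeffZ mcoeffXU.
    by rewrite eqxx mulr1.
  by rewrite (negPf ne) mulr0.
rewrite (dhomog_nemf_coeff hl ne) big1 // => i _; rewrite mcoeffZ mcoeffX.
by case: eqP => [um|]; rewrite ?mulr0 //; rewrite -um mdeg1 eqxx in ne.
Qed.

(* Substituting X_i - l for X_i realizes reduction modulo a linear form l whose
   X_i-coefficient is 1. *)
Definition red_tuple i l : n.+1.-tuple {mpoly K[n.+1]} :=
  [tuple if j == i then 'X_i - l else 'X_j | j < n.+1].
Definition reduce i l := locked (comp_mpoly (red_tuple i l)).

Lemma reduceE i l p : reduce i l p = p \mPo red_tuple i l.
Proof. by rewrite /reduce -lock. Qed.

Variables (i : 'I_n.+1) (l : {mpoly K[n.+1]}).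
Hypotheses (hl : l \is 1.-homog) (l1 : l@_U_(i) = 1).

Lemma reduceX j : reduce i l 'X_j = if j == i then 'X_i - l else 'X_j.
Proof. by rewrite reduceE comp_mpolyXU -tnth_nth tnth_mktuple. Qed.

Lemma reduceM p q : reduce i l (p * q) = reduce i l p * reduce i l q.
Proof. by rewrite !reduceE rmorphM. Qed.

Lemma reduceD p q : reduce i l (p + q) = reduce i l p + reduce i l q.
Proof. by rewrite !reduceE rmorphD. Qed.

Lemma reduceZ c p : reduce i l (c *: p) = c *: reduce i l p.
Proof. by rewrite !reduceE linearZ. Qed.

Lemma reduceC c : reduce i l c%:MP = c%:MP.
Proof. by rewrite reduceE comp_mpolyC. Qed.

Lemma reduce0 : reduce i l 0 = 0.
Proof. by rewrite reduceE raddf0. Qed.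

Lemma reduceP p : exists h, p = reduce i l p + l * h.
Proof.
elim/mpoly_ring_ind: p => [c|j|p q [h {1}->] [k {1}->]|p q [h {1}->] [k {1}->]].
- by exists 0; rewrite reduceC mulr0 addr0.
- by rewrite reduceX; case: eqP => [->|_]; [exists 1|exists 0]; rewrite ?mulr1 ?subrK ?mulr0 ?addr0.
- by exists (h + k); rewrite reduceD; ring.
- by exists (reduce i l p * k + h * reduce i l q + l * h * k); rewrite reduceM; ring.
Qed.

Lemma reduce_self : reduce i l l = 0.
Proof.
rewrite {2}(linear_sumE hl) reduceE raddf_sum /=.
under eq_bigr => j _ do rewrite comp_mpolyZ -reduceE reduceX.
rewrite (bigD1 i) //= eqxx l1 scale1r.
under eq_bigr => j /negPf-> do [].
rewrite {1}(linear_sumE hl) [X in 'X_i - X](bigD1 i) //= l1 scale1r opprD addrA subrr add0r.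
by rewrite addNr.
Qed.

Lemma reduce_eq0 p : reduce i l p = 0 -> exists h, p = l * h.
Proof. by have [h ph] := reduceP p => r0; exists h; rewrite {1}ph r0 add0r. Qed.

Lemma dhomog_reduce k p : p \is k.-homog -> reduce i l p \is k.-homog.
Proof.
rewrite reduceE; apply: dhomog_comp => j; rewrite tnth_mktuple; case: eqP => _.
  by rewrite rpredB // dhomogX; apply/eqP/mdeg1.
by rewrite dhomogX; apply/eqP/mdeg1.
Qed.

(** Since [l] has coefficient 1 at X_i, the form X_i - l is free of X_i. The derivative in X_i
    therefore kills every reduced polynomial, and characteristic 0 turns this into vanishing
    coefficients. *)
Lemma mcoeff_reduce p (m : 'X_{1..n.+1}) : m i != 0%N -> (reduce i l p)@_m = 0.
Proof.
move=> mi; have d0 : (reduce i l p)^`M(i) = 0.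
  elim/mpoly_ring_ind: p => [c|j|p q IHp IHq|p q IHp IHq].
  - by rewrite reduceC mderivC.
  - rewrite reduceX; case: eqP => [_|/eqP ne].
      apply/mpolyP => k; rewrite mcoeff0 mderivB mcoeffB !mcoeff_deriv.
      have [->|k0] := eqVneq k 0%MM; first by rewrite add0m l1 mcoeffX eqxx subrr.
      have nd : mdeg (k + U_(i)) != 1%N by rewrite mdegD mdeg1 addn1 eqSS mdeg_eq0.
      rewrite (dhomog_nemf_coeff hl nd) mcoeffX; case: eqP => [kE|_]; last by rewrite !mul0rn subrr.
      by rewrite -kE mdeg1 eqxx in nd.
    rewrite mderivX mnm1E (negPf ne) scale0r //.
  - by rewrite reduceD mderivD IHp IHq addr0.
  - by rewrite reduceM mderivM IHp IHq mul0r mulr0 addr0.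
have := congr1 (mcoeff (m - U_(i))) d0; rewrite mcoeff0 mcoeff_deriv.
rewrite submK; last by rewrite lep1mP.
by move/eqP; rewrite mulrn_eq0 /= => /eqP.
Qed.
End Substitution.

Section LinearPrime.
Variables (n : nat) (K : numFieldType).
Implicit Types (p q l : {mpoly K[n.+1]}).

Lemma linear_coeff l : l \is 1.-homog -> l != 0 -> exists i, l@_U_(i) != 0.
Proof.
move=> hl l0.
have [/existsP[i ?]|] := boolP [exists i, l@_U_(i) != 0]; first by exists i.
rewrite negb_exists => /forallP l00; case/eqP: l0; rewrite (linear_sumE hl) big1 // => i _.
by have := l00 i; rewrite negbK => /eqP ->; rewrite scale0r.
Qed.

(** After scaling [l], reduction is a ring morphism into a domain whose kernel is generated by
    [l]. *)
Lemma linear_prime l p q : l \is 1.-homog -> l != 0 ->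
  (exists h, p * q = l * h) -> (exists h, p = l * h) \/ (exists h, q = l * h).
Proof.
move=> hl l0; have [i li] := linear_coeff hl l0.
pose l' := (l@_U_(i))^-1 *: l.
have hl' : l' \is 1.-homog by rewrite rpredZ.
have l'1 : l'@_U_(i) = 1 by rewrite mcoeffZ mulVf.
have back r : (exists h, r = l' * h) -> exists h, r = l * h.
  by case=> h ->; exists ((l@_U_(i))^-1 *: h); rewrite -scalerAl scalerAr.
case=> h /(congr1 (reduce i l')); rewrite !reduceM.
have -> : l = l@_U_(i) *: l' by rewrite scalerA mulfV ?scale1r.
rewrite reduceZ reduce_self // scaler0 mul0r => /eqP; rewrite mulf_eq0.
by case/orP => /eqP/(reduce_eq0)/back[k kE]; [left|right]; exists k; rewrite scalerA mulfV ?scale1r.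
Qed.
End LinearPrime.

(** * Complete intersections of two quadrics, and conics *)

Section Families.
Variables (K : numFieldType) (C : finType) (col : C -> 'X_{1..4}) (D : nat).
Hypotheses (D5 : (5 <= D)%N) (leC : ('C(D + 3, D) - 2 <= #|C|)%N).
Local Notation S := {mpoly K[4]}.
Implicit Types (p q f g l : S).

Definition has_coords (v : C -> K) f := forall c, v c = f@_(col c).

Lemma homog_neq0_coeff k p : p \is k.-homog -> p != 0 -> exists u : dmonom 3 k, p@_(mon u) != 0.
Proof.
move=> hp p0; have [/existsP //|] := boolP [exists u : dmonom 3 k, p@_(mon u) != 0].
rewrite negb_exists => /forallP p00; case/eqP: p0; rewrite (homog_sum_mon hp) big1 // => u _.
by have := p00 u; rewrite negbK => /eqP ->; rewrite scale0r.
Qed.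

Lemma neq_coefT k (dl : 'I_k -> nat) i j (u : dmonom 3 (dl i)) (w : dmonom 3 (dl j)) :
  i != j -> (coefT_of u == coefT_of w) = false.
Proof. by move=> ne; apply: contraNF ne => /eqP/(congr1 tag)/= ->. Qed.

Definition in_two_quadrics f := exists q1 q2 g1 g2,
  [/\ q1 \is 2.-homog, q2 \is 2.-homog,
      forall a b, a *: q1 + b *: q2 = 0 -> a = 0 /\ b = 0 & f = q1 * g1 + q2 * g2].

(* Normalizing the pencil leaves 17 = 20 - 3 parameters, and a complete intersection of
   two quadrics imposes 4D conditions on forms of degree D. *)
Lemma thin_two_quadrics :
  thin (fun v => exists2 f, f \is D.-homog /\ in_two_quadrics f & has_coords v f).
Proof.
pose dl (_ : 'I_2) := 2%N.
(* Charts for pencils of quadrics: the first quadric has coefficient 1 at [w.1], the second has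
   coefficients 0 at [w.1] and 1 at [w.2]. *)
pose W := {w : dmonom 3 2 * dmonom 3 2 | w.1 != w.2}.
pose co (i : 'I_2) (u : dmonom 3 2) : coefT 3 dl := @coefT_of 3 2 dl i u.
pose ones (w : W) := [:: co ord0 (val w).1; co ord_max (val w).2].
pose Sw (w : W) := co ord_max (val w).1 :: ones w.
have thinw (w : W) := @thin_ideal 3 2 K dl 'I_2 'I_1 C (@generic_form 3 2 K dl)
  (fun _ => 2%N) (fun _ => 4%N) D col [set x in Sw w] (fun x => (x \in ones w)%:R).
apply: thin_sub (thin_bigU (fun w => thinw w _ _ _)).
- move=> v [f [hf [q1 [q2 [g1 [g2 [h1 h2 ind fE]]]]]] vE].
  have q10 : q1 != 0.
    apply/eqP => q10; have [] := ind 1 0.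
      by rewrite q10 scaler0 scale0r addr0.
    by move/eqP; rewrite oner_eq0.
  have [u1 u1P] := homog_neq0_coeff h1 q10.
  pose r1 := (q1@_(mon u1))^-1 *: q1.
  pose q2' := q2 - q2@_(mon u1) *: r1.
  have q20 : q2' != 0.
    apply/eqP => /eqP; rewrite subr_eq0 => /eqP q20.
    have [] := ind (- (q2@_(mon u1) * (q1@_(mon u1))^-1)) 1.
      by rewrite scale1r {2}q20 /r1 scalerA scaleNr addNr.
    by move=> _ /eqP; rewrite oner_eq0.
  have hr1 : r1 \is 2.-homog by rewrite rpredZ.
  have h2' : q2' \is 2.-homog by rewrite rpredB // rpredZ.
  have r1u1 : r1@_(mon u1) = 1 by rewrite mcoeffZ mulVf.
  have [u2 u2P] := homog_neq0_coeff h2' q20.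
  have q2'u1 : q2'@_(mon u1) = 0 by rewrite mcoeffB mcoeffZ r1u1 mulr1 subrr.
  have ne12 : (u1, u2).1 != (u1, u2).2 :> dmonom 3 2.
    by apply: contraNneq (u2P) => /= <-; rewrite q2'u1.
  pose r2 := (q2'@_(mon u2))^-1 *: q2'.
  have r2u2 : r2@_(mon u2) = 1 by rewrite mcoeffZ mulVf.
  have r2u1 : r2@_(mon u1) = 0 by rewrite mcoeffZ q2'u1 mulr0.
  have hr2 : r2 \is 2.-homog by rewrite rpredZ.
  have q1E : q1 = q1@_(mon u1) *: r1 by rewrite scalerA mulfV // scale1r.
  have q2E : q2 = q2'@_(mon u2) *: r2 + q2@_(mon u1) *: r1.
    by rewrite scalerA mulfV // scale1r subrK.
  exists (exist _ (u1, u2) ne12); exists (fun i : 'I_2 => [:: r1; r2]`_i), (fun i : 'I_2 => [:: r1; r2]`_i).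
  exists (fun _ (i : 'I_2) => [:: r2; - r1]`_i).
  exists (fun i : 'I_2 => [:: q1@_(mon u1) *: g1 + q2@_(mon u1) *: g2; q2'@_(mon u2) *: g2]`_i), f.
  have hr : forall i : 'I_2, [:: r1; r2]`_i \is 2.-homog by case=> [[|[|//]] ?].
  split; [split=> // |split|split=> //].
  + move=> x; rewrite !inE => /or3P[] /eqP ->; rewrite /coefs_of /= ?eqxx ?orbT //=.
    by rewrite r2u1 eq_Tagged /= (negPf ne12).
  + by move=> i; rewrite specialize_generic.
  + by move=> _; case=> [[|[|//]] ?] //=; rewrite rpredN.
  + by move=> _; rewrite !big_ord_recl big_ord0 /=; ring.
  + move=> u u0 j; have := u0 ord0; rewrite big_ord1 /= => /eqP; rewrite mulf_eq0.
    rewrite [j]ord1 => /orP[/eqP //|/eqP r20].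
    by have := r2u2; rewrite r20 mcoeff0 => /esym/eqP; rewrite oner_eq0.
  + rewrite !big_ord_recl big_ord0 /= addr0 fE {1}q1E {1}q2E -!mul_mpolyC; ring.
- by move=> _; lia.
- by move=> _ _; lia.
move=> w; rewrite card_coefT !big_ord_recl !big_ord0 /=.
have -> : #|[set x in Sw w]| = 3%N.
  rewrite cardsE; apply/card_uniqP; rewrite /= !inE [co ord_max _ == co ord0 _]neq_coefT //.
  by rewrite eq_Tagged /= (valP w).
apply: leq_trans leC; rewrite !addn0 /dl.
have [r ->] : exists r, D = (r + 5)%N by exists (D - 5)%N; lia.
have -> : (r + 5 - 2 = r + 3)%N by lia.
have -> : (r + 5 - 4 = r + 1)%N by lia.
have := bin3E 2; have := bin3E (r + 5); have := bin3E (r + 3); have := bin3E (r + 1).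
move: 'C(_, r + 1) 'C(_, r + 3) 'C(_, r + 5) 'C(_, 2) => x1 x3 x5 x2.
lia.
Qed.

Fact linmon_lt (i : 'I_4) : (mdeg U_(i) < 2)%N.
Proof. by rewrite mdeg1. Qed.
Fact linmon_deg (i : 'I_4) : mdeg (BMultinom (linmon_lt i)) == 1%N.
Proof. by apply/eqP/mdeg1. Qed.
Definition linmon (i : 'I_4) : dmonom 3 1 := exist _ (BMultinom (linmon_lt i)) (linmon_deg i).

Lemma linmon_eq i j : (linmon i == linmon j) = (i == j).
Proof. by rewrite -(inj_eq (@mon_inj 3 1)) /mon /= eq_mnm1. Qed.

Definition in_linear_quadric f := exists l q g h,
  [/\ l \is 1.-homog, l != 0, q \is 2.-homog & f = l * g + q * h].

(** The products X_i X_k give four coefficients of a quadric that vanish once X_i is eliminated. *)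
Lemma card_mon2_var (i : 'I_4) : (4 <= #|[set u : dmonom 3 2 | mon u i != 0%N]|)%N.
Proof.
have /fin_all_exists[g gE] k : exists u : dmonom 3 2, mon u = (U_(i) + U_(k))%MM.
  by apply: monP; rewrite mdegD !mdeg1.
have g_inj : injective g.
  move=> a b /(congr1 (@mon 3 2)); rewrite !gE => /addmI/eqP.
  by rewrite eq_mnm1 => /eqP.
rewrite -[X in (X <= _)%N]card_ord -(card_imset _ g_inj) subset_leq_card //.
by apply/subsetP => _ /imsetP[k _ ->]; rewrite inE gE mnmDE mnm1E eqxx.
Qed.

(* Eliminating X_i with l from q and scaling leaves 8 = 14 - 6 parameters, against
   2D + 1 conditions. *)
Lemma thin_linear_quadric :
  thin (fun v => exists2 f, f \is D.-homog /\ in_linear_quadric f & has_coords v f).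
Proof.
pose dl (i : 'I_2) := nth 0%N [:: 1; 2]%N i.
pose W := {w : 'I_4 * dmonom 3 2 | mon w.2 w.1 == 0%N}.
pose cl (i : 'I_4) : coefT 3 dl := @coefT_of 3 2 dl ord0 (linmon i).
pose cq (u : dmonom 3 2) : coefT 3 dl := @coefT_of 3 2 dl ord_max u.
pose ones (w : W) := [:: cl (val w).1; cq (val w).2].
pose Sw (w : W) := cl (val w).1 |: (cq (val w).2 |:
  [set cq u | u : dmonom 3 2 in [set u : dmonom 3 2 | mon u (val w).1 != 0%N]]).
have thinw (w : W) := @thin_ideal 3 2 K dl 'I_2 'I_1 C (@generic_form 3 2 K dl)
  dl (fun _ => 3%N) D col (Sw w) (fun x => (x \in ones w)%:R).
apply: thin_sub (thin_bigU (fun w => thinw w _ _ _)).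
- move=> v [f [hf [l [q [g [h [hl l0 hq fE]]]]]] vE].
  have [i li] := linear_coeff hl l0.
  pose l' := (l@_U_(i))^-1 *: l.
  have hl' : l' \is 1.-homog by rewrite rpredZ.
  have l'1 : l'@_U_(i) = 1 by rewrite mcoeffZ mulVf.
  have l'0 : l' != 0.
    by apply: contraNneq (oner_neq0 K) => l'0; rewrite -l'1 l'0 mcoeff0.
  have lE : l = l@_U_(i) *: l' by rewrite scalerA mulfV // scale1r.
  have [r qE] := reduceP i l' q.
  have [u [q' [c [ui u1 hq' rE q'i]]]] : exists u : dmonom 3 2, exists q' c,
      [/\ mon u i = 0%N, q'@_(mon u) = 1, q' \is 2.-homog, reduce i l' q = c *: q'
        & forall m : 'X_{1..4}, m i != 0%N -> q'@_m = 0].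
    have hr : reduce i l' q \is 2.-homog by apply: dhomog_reduce.
    (* If [l] divides [q] there is no conic to normalize. The square of another variable then serves
       as [q'], with factor [c = 0]. *)
    have [r0|r0] := eqVneq (reduce i l' q) 0.
      have [j ji] : exists j, j != i.
        by exists (if i == ord0 then ord_max else ord0); have [->|] := eqVneq i ord0; rewrite // eq_sym.
      have [|u uE] := @monP 3 2 (U_(j) + U_(j))%MM; first by rewrite mdegD !mdeg1.
      exists u, 'X_[mon u], 0; rewrite mcoeffX eqxx homogX_mon scale0r uE mnmDE !mnm1E.
      rewrite (negPf ji); split=> // m mi; rewrite mcoeffX; case: eqP => // mE.
      by rewrite -mE mnmDE !mnm1E (negPf ji) in mi.
    have [u uP] := homog_neq0_coeff hr r0.
    exists u, (((reduce i l' q)@_(mon u))^-1 *: reduce i l' q), ((reduce i l' q)@_(mon u)).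
    rewrite mcoeffZ mulVf // scalerA mulfV // scale1r rpredZ //; split=> //.
      by apply/eqP; apply: contraTT uP => ui; rewrite negbK mcoeff_reduce.
    by move=> m mi; rewrite mcoeffZ [X in _ * X]mcoeff_reduce // mulr0.
  have ui' : mon (i, u).2 (i, u).1 == 0%N by apply/eqP.
  exists (exist _ (i, u) ui'); exists (fun i : 'I_2 => [:: l'; q']`_i), (fun i : 'I_2 => [:: l'; q']`_i).
  exists (fun _ (i : 'I_2) => [:: q'; - l']`_i).
  exists (fun j : 'I_2 => [:: l@_U_(i) *: g + r * h; c *: h]`_j), f.
  have hr : forall i : 'I_2, [:: l'; q']`_i \is (dl i).-homog by case=> [[|[|//]] ?].
  split; [split=> // |split|split=> //].
  + move=> x; rewrite !inE => /or3P[/eqP->|/eqP->|/imsetP[m]].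
    * by rewrite eqxx.
    * by rewrite eqxx orbT.
    * rewrite inE => mi ->; rewrite /coefs_of /= q'i // eq_Tagged /=.
      by case: eqP => // mu; rewrite mu ui in mi.
  + by move=> j; rewrite specialize_generic.
  + by move=> _; case=> [[|[|//]] ?] //=; rewrite rpredN.
  + by move=> _; rewrite !big_ord_recl big_ord0 /=; ring.
  + move=> w w0 j; have := w0 ord_max; rewrite big_ord1 /= => /eqP; rewrite mulf_eq0.
    by rewrite [j]ord1 oppr_eq0 (negPf l'0) orbF => /eqP.
  + rewrite !big_ord_recl big_ord0 /= addr0 fE {1}lE {1}qE rE -!mul_mpolyC; ring.
- by move=> _ [[|[|//]] ?]; rewrite /dl /=; lia.
- by move=> _ [[|[|//]] ?] _; rewrite /dl /=; lia.
move=> w; rewrite card_coefT !big_ord_recl !big_ord0 /=.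
have : (6 <= #|Sw w|)%N.
  rewrite !cardsU1 card_imset; last first.
    by move=> a b /eqP; rewrite eq_Tagged => /eqP.
  have -> : cl (val w).1 \notin cq (val w).2 |:
      [set cq u | u : dmonom 3 2 in [set u : dmonom 3 2 | mon u (val w).1 != 0%N]].
    rewrite !inE neq_coefT //=; apply/imsetP => -[u _ /eqP].
    by rewrite neq_coefT.
  have -> : cq (val w).2 \notin
      [set cq u | u : dmonom 3 2 in [set u : dmonom 3 2 | mon u (val w).1 != 0%N]].
    apply/imsetP => -[u]; rewrite inE => ui /eqP; rewrite eq_Tagged /= => /eqP uE.
    by rewrite -uE (eqP (valP w)) in ui.
  by rewrite /= !add1n !ltnS card_mon2_var.
move=> S6; apply: leq_trans leC; rewrite !addn0 /dl /=.
have [r ->] : exists r, D = (r + 5)%N by exists (D - 5)%N; lia.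
have -> : (r + 5 - 1 = r + 4)%N by lia.
have -> : (r + 5 - 2 = r + 3)%N by lia.
have -> : (r + 5 - 3 = r + 2)%N by lia.
have := bin3E 1; have := bin3E 2; have := bin3E (r + 5); have := bin3E (r + 4).
have := bin3E (r + 3); have := bin3E (r + 2).
move: 'C(_, r + 2) 'C(_, r + 3) 'C(_, r + 4) 'C(_, r + 5) 'C(_, 2) 'C(_, 1) S6 => x2 x3 x4 x5 y2 y1.
move: #|Sw w| => s.
lia.
Qed.
End Families.

(** * Determinantal curves *)

Section Determinantal.
Variables (K : numFieldType) (C : finType) (col : C -> 'X_{1..4}) (D : nat).
Hypotheses (D5 : (5 <= D)%N) (leC : ('C(D + 3, D) - 2 <= #|C|)%N).
Local Notation S := {mpoly K[4]}.
Local Notation w := ('X_ord_max : S).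
Implicit Types (p q f g l : S).

Lemma mcoeff1_neq0 p m : p@_m = 1 -> p != 0.
Proof. by move=> p1; apply: contraNneq (oner_neq0 K) => p0; rewrite -p1 p0 mcoeff0. Qed.

Lemma homogXU (i : 'I_4) : ('X_i : S) \is 1.-homog.
Proof. by rewrite dhomogX; apply/eqP/mdeg1. Qed.

Lemma reduce_var_id l (i : 'I_4) : l \is 1.-homog -> l@_U_(i) = 0 -> reduce i 'X_i l = l.
Proof.
move=> hl li; rewrite {2}(linear_sumE hl) {1}(linear_sumE hl) reduceE raddf_sum /=.
apply: eq_bigr => j _; rewrite comp_mpolyZ -reduceE reduceX.
by case: eqP => // ->; rewrite li !scale0r.
Qed.

Lemma reduce_var0 (i : 'I_4) : reduce i 'X_i 'X_i = 0 :> S.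
Proof. by rewrite reduceX eqxx subrr. Qed.

(** The conditions at [ord_max] say that a, b1, b2 are free of w, every multiple of w having gone
    into c1 and c2; they supply three of the seven fixed coefficients. *)
Definition in_determinantal f := exists a b1 b2 c1 c2 g1 g2 g3 : S,
  [/\ [/\ a \is 1.-homog, b1 \is 1.-homog, b2 \is 1.-homog, c1 \is 1.-homog & c2 \is 1.-homog],
      [/\ a@_U_(ord_max) = 0, b1@_U_(ord_max) = 0 & b2@_U_(ord_max) = 0],
      a != 0, forall x y, x *: b1 + y *: b2 = 0 -> x = 0 /\ y = 0
    & f = (a * b1 + w * c1) * g1 + (a * b2 + w * c2) * g2 + (b1 * c2 - b2 * c1) * g3].

(** The ideal of minors does not change when the second row of the matrix is scaled or column
    operations are applied to its first two columns. Scaling the row makes a coefficient of a equal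
    to 1; the column operations put (b1, b2) in echelon form, fixing three more. *)
Lemma in_determinantal_normal f : in_determinantal f ->
  exists a b1 b2 c1 c2 g1 g2 g3 : S, exists i0 i1 i2 : 'I_4,
  [/\ [/\ a \is 1.-homog, b1 \is 1.-homog, b2 \is 1.-homog, c1 \is 1.-homog & c2 \is 1.-homog],
      [/\ a@_U_(ord_max) = 0, b1@_U_(ord_max) = 0 & b2@_U_(ord_max) = 0],
      [/\ a@_U_(i0) = 1, b1@_U_(i1) = 0, b2@_U_(i1) = 1 & b1@_U_(i2) = 1],
      [&& i0 != ord_max, i1 != ord_max, i2 != ord_max & i1 != i2]
    & f = (a * b1 + w * c1) * g1 + (a * b2 + w * c2) * g2 + (b1 * c2 - b2 * c1) * g3].
Proof.
case=> a [b1 [b2 [c1 [c2 [g1 [g2 [g3]]]]]]].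
case=> -[ha hb1 hb2 hc1 hc2] [aw b1w b2w] a0 ind fE.
have [i0 ai0] := linear_coeff ha a0; set al := a@_U_(i0) in ai0.
have b20 : b2 != 0.
  apply/eqP => b20; have [] := ind 0 1; first by rewrite b20 scale0r scaler0 addr0.
  by move=> _ /eqP; rewrite oner_eq0.
have [i1 bi1] := linear_coeff hb2 b20; set be := b2@_U_(i1) in bi1.
pose b2' := be^-1 *: b2; pose c2' := (al * be)^-1 *: c2.
pose s := b1@_U_(i1).
pose b := b1 - s *: b2'; pose c := al^-1 *: c1 - s *: c2'.
have hb2' : b2' \is 1.-homog by rewrite rpredZ.
have hc2' : c2' \is 1.-homog by rewrite rpredZ.
have hb : b \is 1.-homog by rewrite rpredB // rpredZ.
have hc : c \is 1.-homog by rewrite rpredB // rpredZ.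
have b0 : b != 0.
  rewrite /b /b2' scalerA -scaleNr; apply/eqP => b0; have [] := ind 1 (- (s * be^-1)).
    by rewrite scale1r.
  by move/eqP; rewrite oner_eq0.
have [i2 bi2] := linear_coeff hb b0; set ga := b@_U_(i2) in bi2.
have b2'1 : b2'@_U_(i1) = 1 by rewrite mcoeffZ mulVf.
have bi1' : b@_U_(i1) = 0 by rewrite mcoeffB mcoeffZ b2'1 mulr1 subrr.
have b2'w : b2'@_U_(ord_max) = 0 by rewrite mcoeffZ b2w mulr0.
have bw : b@_U_(ord_max) = 0 by rewrite mcoeffB mcoeffZ b2'w b1w mulr0 subrr.
pose A : S := al%:MP; pose A' : S := al^-1%:MP; pose B : S := be%:MP.
pose Ga : S := ga%:MP; pose T : S := s%:MP.
exists (al^-1 *: a), (ga^-1 *: b), b2', (ga^-1 *: c), c2'.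
exists (A * Ga * g1), (A * (T * g1 + B * g2)), (A * Ga * B * g3), i0, i1, i2.
split.
- by rewrite !rpredZ.
- by rewrite b2'w mcoeffZ aw mcoeffZ bw !mulr0.
- by rewrite b2'1 mcoeffZ mulVf // mcoeffZ bi1' mulr0 mcoeffZ mulVf.
- apply/and4P; split; [apply: contraNneq ai0 | apply: contraNneq bi1 | apply: contraNneq bi2 | apply: contraNneq bi2] => ie.
  + by rewrite /al ie aw.
  + by rewrite /be ie b2w.
  + by rewrite /ga ie bw.
  + by rewrite /ga -ie bi1'.
have aE : a = A * (al^-1 *: a) by rewrite mul_mpolyC scalerA mulfV // scale1r.
have b2E : b2 = B * b2' by rewrite mul_mpolyC scalerA mulfV // scale1r.
have b1E : b1 = Ga * (ga^-1 *: b) + T * b2'.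
  by rewrite !mul_mpolyC scalerA mulfV // scale1r /b subrK.
have c2E : c2 = A * B * c2'.
  by rewrite -mpolyCM mul_mpolyC scalerA mulfV ?scale1r // mulf_neq0.
have c1E : c1 = A * (Ga * (ga^-1 *: c) + T * c2').
  by rewrite !mul_mpolyC scalerA mulfV // scale1r /c subrK scalerA mulfV // scale1r.
rewrite fE {1 2}aE {1 2}b1E {1 2}b2E {1 2}c1E {1 2}c2E. ring.
Qed.

(* The coefficients of the linear forms a, b1, b2 fixed by [in_determinantal_normal]: those
   in [chart_ones] are 1, the others in [chart] are 0. *)
Section Chart.
Variables (T : eqType) (cf : 'I_5 -> 'I_4 -> T) (o0 o1 o2 : 'I_5) (j i0 i1 i2 : 'I_4).
Hypotheses (cfE : forall k i i', (cf k i == cf k i') = (i == i')).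
Hypotheses (cfN : forall k k' i i', k != k' -> (cf k i == cf k' i') = false).
Hypotheses (o01 : o0 != o1) (o02 : o0 != o2) (o12 : o1 != o2).
Hypotheses (i0j : i0 != j) (i1j : i1 != j) (i2j : i2 != j) (i12 : i1 != i2).

Definition chart_ones := [:: cf o0 i0; cf o2 i1; cf o1 i2].
Definition chart := [:: cf o0 j; cf o1 j; cf o2 j; cf o1 i1] ++ chart_ones.

Let o10 : o1 != o0. Proof. by rewrite eq_sym. Qed.
Let o20 : o2 != o0. Proof. by rewrite eq_sym. Qed.
Let o21 : o2 != o1. Proof. by rewrite eq_sym. Qed.
Let ji0 : (j == i0) = false. Proof. by rewrite eq_sym (negPf i0j). Qed.
Let ji1 : (j == i1) = false. Proof. by rewrite eq_sym (negPf i1j). Qed.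
Let ji2 : (j == i2) = false. Proof. by rewrite eq_sym (negPf i2j). Qed.

Lemma uniq_chart : uniq chart.
Proof. by rewrite /chart /chart_ones /= !inE !cfE ji0 ji1 ji2 (negPf i12) !cfN. Qed.

Lemma chart_values (v : T -> K) :
  v (cf o0 j) = 0 -> v (cf o1 j) = 0 -> v (cf o2 j) = 0 -> v (cf o1 i1) = 0 ->
  v (cf o0 i0) = 1 -> v (cf o2 i1) = 1 -> v (cf o1 i2) = 1 ->
  {in chart, v =1 fun c => (c \in chart_ones)%:R}.
Proof.
move=> v0j v1j v2j v11 v00 v21 v12 c; rewrite /chart /chart_ones !inE.
by case/or4P=> [/eqP->|/eqP->|/eqP->|/or4P[/eqP->|/eqP->|/eqP->|/eqP->]];
  rewrite ?v0j ?v1j ?v2j ?v11 ?v00 ?v21 ?v12 !cfE ?cfN ?ji0 ?ji1 ?ji2 ?(negPf i12) ?eqxx ?orbT.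
Qed.
End Chart.

(* 13 = 20 - 7 parameters, against 3D + 1 conditions. *)
Lemma thin_determinantal :
  thin (fun v => exists2 f, f \is D.-homog /\ in_determinantal f & has_coords col v f).
Proof.
pose dl (_ : 'I_5) := 1%N.
pose W := {x : 'I_4 * 'I_4 * 'I_4 |
   [&& x.1.1 != ord_max, x.1.2 != ord_max, x.2 != ord_max & x.1.2 != x.2]}.
pose cf (k : 'I_5) (i : 'I_4) : coefT 3 dl := @coefT_of 3 5 dl k (linmon i).
have cfE k i j : (cf k i == cf k j) = (i == j) by rewrite eq_Tagged /= linmon_eq.
have cfN k k' i j : k != k' -> (cf k i == cf k' j) = false by apply: neq_coefT.
pose o0 : 'I_5 := @Ordinal 5 0 isT. pose o1 : 'I_5 := @Ordinal 5 1 isT.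
pose o2 : 'I_5 := @Ordinal 5 2 isT. pose o3 : 'I_5 := @Ordinal 5 3 isT.
pose o4 : 'I_5 := @Ordinal 5 4 isT.
pose ones (x : W) := chart_ones cf o0 o1 o2 (val x).1.1 (val x).1.2 (val x).2.
pose Sx (x : W) := chart cf o0 o1 o2 ord_max (val x).1.1 (val x).1.2 (val x).2.
pose ge := @generic_form 3 5 K dl.
pose wg : {mpoly {mpoly K[#|{: coefT 3 dl}|]}[4]} := 'X_ord_max.
pose gens := [:: ge o0 * ge o1 + wg * ge o3; ge o0 * ge o2 + wg * ge o4;
  ge o1 * ge o4 - ge o2 * ge o3].
have thinx (x : W) := @thin_ideal 3 5 K dl 'I_3 'I_2 C (fun i => gens`_i)
  (fun _ => 2%N) (fun _ => 3%N) D col [set y in Sx x] (fun y => (y \in ones x)%:R).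
apply: thin_sub (thin_bigU (fun x => thinx x _ _ _)).
- move=> v [f [hf /in_determinantal_normal]].
  case=> a [b1 [b2 [c1 [c2 [g1 [g2 [g3 [i0 [i1 [i2]]]]]]]]]].
  case=> -[ha hb1 hb2 hc1 hc2] [aw b1w b2w] [ai0 b1i1 b2i1 b1i2] i012 fE vE.
  have a0 := mcoeff1_neq0 ai0.
  exists (exist _ (i0, i1, i2) i012).
  pose F (i : 'I_5) := [:: a; b1; b2; c1; c2]`_i.
  pose p := [:: a * b1 + w * c1; a * b2 + w * c2; b1 * c2 - b2 * c1].
  (* Hilbert-Burch syzygies: expanding a 3x3 determinant with a repeated row shows that each row of
     the matrix, up to order and signs, annihilates the minors. *)
  pose Z := [:: [:: b2; - b1; w]; [:: c2; - c1; - a]].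
  exists F, (fun i : 'I_3 => p`_i), (fun (j : 'I_2) (i : 'I_3) => (nth [::] Z j)`_i).
  exists (fun i : 'I_3 => [:: g1; g2; g3]`_i), f.
  have hF : forall i : 'I_5, F i \is 1.-homog by case=> [[|[|[|[|[|//]]]]] ?].
  have hw := homogXU ord_max.
  split; [split=> // |split|split=> //].
  + have [n0 n1 n2 n12] := and4P i012.
    move=> c; rewrite inE; exact: (chart_values cfE cfN).
  + have spE k : specialize F (ge k) = F k by rewrite specialize_generic.
    have spw : specialize F wg = w by exact: specializeX.
    have sp0 : specialize F (ge o0 * ge o1 + wg * ge o3) = a * b1 + w * c1.
      exact: (specialize_mulD (spE o0) (spE o1) spw (spE o3)).
    have sp1 : specialize F (ge o0 * ge o2 + wg * ge o4) = a * b2 + w * c2.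
      exact: (specialize_mulD (spE o0) (spE o2) spw (spE o4)).
    have sp2 : specialize F (ge o1 * ge o4 - ge o2 * ge o3) = b1 * c2 - b2 * c1.
      exact: (specialize_mulB (spE o1) (spE o4) (spE o2) (spE o3)).
    by case=> [[|[|[|//]]] ?]; [exact: sp0 | exact: sp1 | exact: sp2].
  + by case=> [[|[|[|//]]] ?] /=; rewrite ?rpredB ?rpredD // -[2%N]/(1 + 1)%N dhomogM.
  + by case=> [[|[|//]] ?]; case=> [[|[|[|//]]] ?] //=; rewrite rpredN.
  + by case=> [[|[|//]] ?]; rewrite !big_ord_recl big_ord0 /=; ring.
  + move=> u uZ.
    have := uZ ord0; have := uZ ord_max; rewrite !big_ord_recl !big_ord0 /= !addr0.
    set u0 := u ord0; set u1 := u _ => e2 e0.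
    (* Eliminating [u1] leaves [u0] times a maximal minor of [Z], which is nonzero because modulo w
       it is a b2. *)
    have e1 : u0 * (a * b2 + w * c2) = 0.
      transitivity (a * (u0 * b2 + u1 * c2) + c2 * (u0 * w + u1 * - a)); first by ring.
      by rewrite e0 e2 !mulr0 addr0.
    have p1 : a * b2 + w * c2 != 0.
      apply/eqP => /(congr1 (reduce ord_max 'X_ord_max)); rewrite reduceD !reduceM reduce_var0.
      rewrite reduce0.
      rewrite mul0r addr0 !reduce_var_id // => /eqP.
      by rewrite mulf_eq0 (negPf a0) (negPf (mcoeff1_neq0 b2i1)).
    move/eqP: e1; rewrite mulf_eq0 (negPf p1) orbF => /eqP u00.
    move: e2; rewrite u00 mul0r add0r => /eqP; rewrite mulf_eq0 oppr_eq0 (negPf a0) orbF => /eqP u10.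
    case=> [[|[|//]] j]; [rewrite -[RHS]u00 | rewrite -[RHS]u10]; apply: (congr1 u); exact: val_inj.
  + by rewrite !big_ord_recl big_ord0 /= addr0 addrA.
- by move=> _; lia.
- by move=> _ _; lia.
move=> x; rewrite card_coefT !big_ord_recl !big_ord0 /=.
have -> : #|[set y in Sx x]| = 7%N.
  rewrite cardsE; apply/card_uniqP.
  by have /and4P[n0 n1 n2 n12] := valP x; apply: uniq_chart cfE cfN _ _ _ _ _ _ _.
apply: leq_trans leC; rewrite !addn0 /dl /=.
have [r ->] : exists r, D = (r + 5)%N by exists (D - 5)%N; lia.
have -> : (r + 5 - 2 = r + 3)%N by lia.
have -> : (r + 5 - 3 = r + 2)%N by lia.
have := bin3E 1; have := bin3E (r + 5).
have := bin3E (r + 3); have := bin3E (r + 2).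
move: 'C(_, r + 2) 'C(_, r + 3) 'C(_, r + 5) 'C(_, 1) => x2 x3 x5 y1.
lia.
Qed.
End Determinantal.

(** * Syzygies of two quadrics *)

Section LineRestriction.
Variables (n : nat) (K : numFieldType) (al : 'I_n.+1 -> K).
Local Notation U := {mpoly K[n.+1]}.
Implicit Types (p q l : U).

(** Substitutes X + T al for X. In a direction with q(al) != 0, a quadric becomes a polynomial in T
    whose leading coefficient is a nonzero constant, and T = 0 gives the quadric back. *)
Definition line_restr : U -> {poly U} :=
  locked (mmap (polyC \o @mpolyC n.+1 K) (fun i => ('X_i)%:P + ((al i)%:MP)%:P * 'X)).

Lemma line_restrD : {morph line_restr : p q / p + q}.
Proof. by rewrite /line_restr -lock; apply: mmapD. Qed.

Lemma line_restrM : {morph line_restr : p q / p * q}.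
Proof.
move=> p q; rewrite /line_restr -lock.
have [M _] := mmap_is_multiplicative
  (fun i => (('X_i)%:P : {poly U}) + ((al i)%:MP)%:P * 'X) (polyC \o @mpolyC n.+1 K).
exact: M.
Qed.

Lemma line_restrC c : line_restr c%:MP = c%:MP%:P.
Proof. by rewrite /line_restr -lock mmapC. Qed.

Lemma line_restrX i : line_restr 'X_i = ('X_i)%:P + ((al i)%:MP)%:P * 'X.
Proof. by rewrite /line_restr -lock mmapX mmap1U. Qed.

Lemma line_restr0 p : (line_restr p).[0] = p.
Proof.
elim/mpoly_ring_ind: p => [c|i|p q IHp IHq|p q IHp IHq].
- by rewrite line_restrC hornerC.
- by rewrite line_restrX !hornerE ?mulr0 ?addr0.
- by rewrite line_restrD hornerD IHp IHq.
- by rewrite line_restrM hornerM IHp IHq.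
Qed.

Lemma mdeg2P (m : 'X_{1..n.+1}) : mdeg m = 2%N -> exists i j, m = (U_(i) + U_(j))%MM.
Proof.
move=> m2; have [/existsP[i mi]|] := boolP [exists i, m i != 0%N]; last first.
  rewrite negb_exists => /forallP m0; suff m00 : m = 0%MM by rewrite m00 mdeg0 in m2.
  by apply/mnmP => i; rewrite mnm0E; apply/eqP; have := m0 i; rewrite negbK.
have mE : m = (U_(i) + (m - U_(i)))%MM by rewrite addmC submK // lep1mP.
have : mdeg (m - U_(i))%MM == 1%N by apply/eqP; move: m2; rewrite {1}mE mdegD mdeg1; lia.
by case/mdeg1P => j /eqP mj; exists i, j; rewrite -mj.
Qed.

Lemma line_restr_quadric q : q \is 2.-homog -> exists2 b : U, b \is 1.-homog &
  line_restr q = q%:P + b%:P * 'X + ((q.@[al])%:MP)%:P * 'X^2.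
Proof.
move=> /homog_sum_mon ->; apply: (big_ind (fun q => exists2 b : U, b \is 1.-homog &
  line_restr q = q%:P + b%:P * 'X + ((q.@[al])%:MP)%:P * 'X^2)).
- by exists 0; rewrite ?rpred0 // -mpolyC0 line_restrC mevalC mpolyC0 !polyC0 !mul0r !addr0.
- move=> p1 p2 [b1 h1 e1] [b2 h2 e2]; exists (b1 + b2); first by rewrite rpredD.
  by rewrite line_restrD e1 e2 mevalD mpolyCD !polyCD; ring.
move=> u _; have [i [j ->]] := mdeg2P (mdeg_mon u); set c := mcoeff _ _.
exists (c *: (al j *: 'X_i + al i *: 'X_j)).
  by rewrite rpredZ // rpredD // rpredZ // dhomogX; apply/eqP/mdeg1.
rewrite mpolyXD -!mul_mpolyC !line_restrM line_restrC !line_restrX !mevalM.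
rewrite mevalC !mevalXU !mpolyCM !polyCM !polyCD !polyCM; ring.
Qed.
End LineRestriction.

(** Division by the monic [p] leaves a remainder whose multiple by [c] is divisible by [p] yet of
    smaller size, hence zero. *)
Lemma monic_dvd_scaled (R : idomainType) (c : R) (p q h : {poly R}) :
  p \is monic -> c != 0 -> c%:P * q = p * h -> exists a, q = p * a.
Proof.
move=> mp c0 cq; exists (Pdiv.Ring.rdivp q p).
have qE := Pdiv.RingMonic.rdivp_eq mp q.
set a := Pdiv.Ring.rdivp q p in qE *; set r := Pdiv.Ring.rmodp q p in qE.
have r_lt : (size r < size p)%N by rewrite Pdiv.Ring.ltn_rmodpN0 // monic_neq0.
have crE : c%:P * r = p * (h - c%:P * a) by rewrite mulrBr -cq qE; ring.
have cP0 : c%:P != 0 by rewrite polyC_eq0.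
have [h0|h0] := eqVneq (h - c%:P * a) 0.
  move/eqP: crE; rewrite h0 mulr0 mulf_eq0 (negPf cP0) => /eqP r0.
  by rewrite qE r0 addr0 mulrC.
have : size (c%:P * r) = size (p * (h - c%:P * a)) by rewrite crE.
rewrite mul_polyC size_scale // size_monicM //.
have : (0 < size (h - c%:P * a)%R)%N by rewrite size_poly_gt0.
by move: r_lt; move: (size r) (size p) (size (h - c%:P * a)%R) => x y z; lia.
Qed.

(** Pseudo-division of the quadratic by l X + s: the remainder is l^2 times its value at -s/l, the
    resultant of the two. *)
Lemma linear_resultant (R : comNzRingType) (l s a b : R) :
  (l ^+ 2)%:P * ('X^2 + a%:P * 'X + b%:P) =
    (l%:P * 'X + s%:P) * (l%:P * 'X + (l * a - s)%:P) + (l ^+ 2 * b - l * s * a + s ^+ 2)%:P.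
Proof. by rewrite !expr2 !polyCD !polyCN !polyCM; ring. Qed.

(** With [r] the resultant of [P] and [L], eliminating [L] shows that [P] divides [r * G]; for monic
    [P] and nonzero [r] it then divides [G]. *)
Lemma linear_syzygy (R : comNzRingType) (k P L M r E X G : R) :
  k * P = L * M + r -> E * P * X + L * G = 0 -> r * G = P * (k * G + E * M * X).
Proof.
move=> kP /eqP; rewrite addr_eq0 => /eqP EX.
have -> : r = k * P - L * M by rewrite kP addrC addKr.
transitivity (P * (k * G) - M * (L * G)); first by ring.
by rewrite -[L * G]opprK -EX; ring.
Qed.

Lemma linear_syzygy_factor (R : idomainType) (P L E X G A : R) :
  P != 0 -> E * P * X + L * G = 0 -> G = P * A -> E * X = - (L * A).
Proof.
move=> P0 /eqP; rewrite addr_eq0 => /eqP EX GE; apply: (mulfI P0).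
by rewrite mulrA [P * E]mulrC EX GE mulrN mulrCA.
Qed.

(* Restricting to a general line makes q1 monic in the parameter T, and then
   q2 - c q1 = l T + s: the resultant l^2 beta - l s alpha + s^2 decides whether the
   two quadrics are coprime. *)
Lemma quadric_syzygy n (K : numFieldType) (q1 q2 g1 g2 : {mpoly K[n.+1]}) :
  q1 \is 2.-homog -> q2 \is 2.-homog -> q1 * g1 + q2 * g2 = 0 ->
  [\/ exists h, g1 = h * q2 /\ g2 = - (h * q1),
      exists x y, (x, y) != (0, 0) /\ x *: q1 + y *: q2 = 0
    | exists a b1 b2, [/\ a \is 1.-homog, b1 \is 1.-homog, b2 \is 1.-homog,
        q1 = a * b1 & q2 = a * b2]].
Proof.
move=> h1 h2 rel; have [q10|/mpoly_nonroot[al e0]] := eqVneq q1 0.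
  constructor 2; exists 1, 0; rewrite q10 scale0r scaler0 addr0; split=> //.
  by rewrite xpair_eqE oner_eq0.
set e := q1.@[al] in e0; have [b hb Q1E] := line_restr_quadric al h1.
have [b' hb' Q2E] := line_restr_quadric al h2.
(* This [c] cancels the T^2 term of q2 against that of q1, so q2 - c q1 becomes linear in T. *)
pose c : K := q2.@[al] / e; pose E := e%:MP_[n.+1]; pose E' := e^-1%:MP_[n.+1]; pose c' := c%:MP_[n.+1].
have EE : E * E' = 1 by rewrite -mpolyCM mulfV.
pose s := q2 - c' * q1; pose l := b' - c' * b; pose alp := E' * b; pose bet := E' * q1.
have hs : s \is 2.-homog by rewrite /s mul_mpolyC rpredB // rpredZ.
have hl : l \is 1.-homog by rewrite /l mul_mpolyC rpredB // rpredZ.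
have ha : alp \is 1.-homog by rewrite /alp mul_mpolyC rpredZ.
have q2E : q2 = c' * q1 + s by rewrite /s addrC subrK.
have q1E : q1 = E * bet by rewrite mulrA EE mul1r.
have [s0|s0] := eqVneq s 0.
  constructor 2; exists c, (-1); rewrite scaleN1r {1}q2E s0 addr0 mul_mpolyC subrr.
  by rewrite xpair_eqE oppr_eq0 oner_eq0 andbF.
pose T : {poly {mpoly K[n.+1]}} := 'X.
pose P1 := T ^+ 2 + alp%:P * T + bet%:P; pose L := l%:P * T + s%:P.
have Q1 : line_restr al q1 = E%:P * P1.
  rewrite Q1E -/e -/E -/T /P1 /alp /bet !polyCM.
  rewrite -[X in X + _ + _]mul1r -[X in _ + X * _ + _]mul1r -polyC1 -EE polyCM; ring.
have Q2 : line_restr al q2 = L + c'%:P * (E%:P * P1).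
  rewrite -Q1 Q1E Q2E -/e /L /s /l !polyCB !polyCM.
  have -> : (q2.@[al])%:MP = c' * E by rewrite -mpolyCM mulfVK.
  rewrite polyCM -/E /T; ring.
pose R := l ^+ 2 * bet - l * s * alp + s ^+ 2.
have resE : (l ^+ 2)%:P * P1 = L * (l%:P * T + (l * alp - s)%:P) + R%:P.
  exact: linear_resultant.
pose G1 := line_restr al g1; pose G2 := line_restr al g2.
have relT : E%:P * P1 * (G1 + c'%:P * G2) + L * G2 = 0.
  have := congr1 (line_restr al) rel; rewrite line_restrD !line_restrM -mpolyC0 line_restrC mpolyC0 polyC0 Q1 Q2 -/G1 -/G2 => <-.
  by ring.
(* If R = 0, then l divides s^2, hence s = l k1, and R = 0 becomes bet = k1 (alp - k1): the linear
   form k1 divides both quadrics. *)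
have [R0|R0] := eqVneq R 0.
  have l0 : l != 0.
    apply: contraNneq s0 => l0; apply/eqP; move/eqP: R0.
    by rewrite /R l0 expr0n !mul0r subrr add0r mulf_eq0 orbb => /eqP.
  have [k sk] : exists k, s = l * k.
    have : exists h, s * s = l * h.
      exists (s * alp - l * bet); rewrite -[LHS]subr0 -R0 /R; ring.
    by case/(linear_prime hl l0).
  pose k1 := pihomog mdeg 1 k.
  have sk1 : s = l * k1 by rewrite -(pihomog_dE hs) sk (pihomogM _ hl).
  have hk1 : k1 \is 1.-homog by apply: pihomogP.
  have betE : bet = k1 * (alp - k1).
    have : l ^+ 2 * (bet - k1 * (alp - k1)) = 0 by rewrite -R0 /R sk1; ring.
    by move/eqP; rewrite mulf_eq0 expf_eq0 /= (negPf l0) /= subr_eq0 => /eqP.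
  have hm : E * (alp - k1) \is 1.-homog by rewrite mul_mpolyC rpredZ // rpredB.
  constructor 3; exists k1, (E * (alp - k1)), (c' * (E * (alp - k1)) + l); split=> //.
  - by rewrite rpredD // mul_mpolyC rpredZ.
  - by rewrite q1E betE; ring.
  - by rewrite q2E q1E betE sk1; ring.
constructor 1.
have mP1 : P1 \is monic.
  rewrite /P1 -addrA monicE lead_coefDl ?lead_coefXn // size_polyXn.
  apply: leq_ltn_trans (size_polyD _ _) _; rewrite gtn_max !ltnS.
  by rewrite (leq_trans (size_polyMleq _ _)) ?size_polyX ?(leq_trans (size_polyC_leq1 _)) // size_polyC; case: (_ == _).
have [|A G2E] := @monic_dvd_scaled _ R P1 G2
   ((l ^+ 2)%:P * G2 + E%:P * (l%:P * T + (l * alp - s)%:P) * (G1 + c'%:P * G2)) mP1 R0.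
  exact: linear_syzygy resE relT.
have G1E : E%:P * (G1 + c'%:P * G2) = - (L * A).
  exact: linear_syzygy_factor (monic_neq0 mP1) relT G2E.
(* Setting T = 0 brings the divisibility found over T back to g1 and g2. *)
have g2E : g2 = bet * A.[0].
  have P10 : P1.[0] = bet.
    by rewrite /P1 /T !(hornerD, hornerM, hornerX, hornerXn, hornerC) mulr0 expr0n !add0r.
  by rewrite -[LHS](line_restr0 al) -/G2 G2E hornerM P10.
have g1E : E * (g1 + c' * g2) = - (s * A.[0]).
  have := congr1 (horner^~ 0) G1E.
  by rewrite /= /L /T !(hornerN, hornerD, hornerM, hornerX, hornerC) mulr0 add0r /G1 /G2 !line_restr0.
exists (- (E' * A.[0])); split.
  rewrite -[LHS]mul1r -EE; transitivity (E' * (E * (g1 + c' * g2)) - E * E' * c' * g2); first by ring.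
  by rewrite g1E g2E q2E EE mul1r /bet; ring.
by rewrite g2E /bet; ring.
Qed.

(** * Removing a plane *)

Section RegularPairs.
Variables (n : nat) (K : numFieldType).
Local Notation S := {mpoly K[n.+1]}.
Local Notation in_ideal := (@in_ideal n.+1 K).
Local Notation regular_seq := (@regular_seq n.+1 K).
Implicit Types (p q g h : S).

Lemma in_ideal_nil g : in_ideal [::] g <-> g = 0.
Proof. by split=> [[hs ->]|->]; [|exists [::]]; rewrite big_ord0. Qed.

Lemma in_ideal1 p g : in_ideal [:: p] g <-> exists h, g = h * p.
Proof.
split=> [[hs ->]|[h ->]]; first by exists hs`_0; rewrite big_ord1.
by exists [:: h]; rewrite big_ord1.
Qed.

Lemma regular_pairP q1 q2 : q1@_0%MM = 0 -> q2@_0%MM = 0 -> q1 != 0 ->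
  (forall g h, q2 * g = h * q1 -> exists k, g = k * q1) -> regular_seq [:: q1; q2].
Proof.
move=> q10 q20 q1N0 div; split=> [[hs /(congr1 (mcoeff 0%MM))]|].
  rewrite !big_ord_recl big_ord0 addr0 mcoeffD !(rmorphM (mcoeff 0%MM)) /= q10 q20 !mulr0 addr0.
  by rewrite mcoeff1 eqxx => /eqP; rewrite oner_eq0.
case=> [|[|//]] _ g /=.
  by rewrite !in_ideal_nil => /eqP; rewrite mulf_eq0 (negPf q1N0) => /eqP.
by rewrite !in_ideal1 => -[h /div].
Qed.

Lemma regular_pair_neq0 q1 q2 : regular_seq [:: q1; q2] -> q1 != 0.
Proof.
case=> _ /(_ 0%N isT 1); rewrite /= !in_ideal_nil mulr1 => q1_reg.
by apply/eqP => /q1_reg/eqP; rewrite oner_eq0.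
Qed.

(** From (u b) a = b (u a), regularity makes a a multiple of u a, so u is invertible. Hence a form
    of positive degree never divides both members of a regular pair. *)
Lemma regular_pair_coprime u a b : regular_seq [:: u * a; u * b] -> u@_0%MM != 0.
Proof.
move=> reg; apply/eqP => u0; have := regular_pair_neq0 reg.
rewrite mulf_eq0 negb_or => /andP[_ a0].
case: reg => _ /(_ 1%N isT a); rewrite /= !in_ideal1 => -[|h].
  by exists b; ring.
move=> aE; have : a * (1 - h * u) = 0 by rewrite mulrBr mulr1 {1}aE; ring.
move/eqP; rewrite mulf_eq0 (negPf a0) subr_eq0 /= => /eqP/(congr1 (mcoeff 0%MM)).
rewrite (rmorphM (mcoeff 0%MM)) /= u0 mulr0 mcoeff1 eqxx => /eqP.
by rewrite oner_eq0.
Qed.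

Lemma dhomog_mcoeff0 k p : p \is k.+1.-homog -> p@_0%MM = 0.
Proof. by move=> hp; apply: (dhomog_nemf_coeff hp); rewrite /= mdeg0. Qed.

Lemma dhomog0_const p : p \is 0.-homog -> p = (p@_0%MM)%:MP.
Proof.
move=> hp; apply/mpolyP => m; rewrite mcoeffC.
have [->|m0] := eqVneq m 0%MM; first by rewrite mulr1.
by rewrite mulr0; apply: (dhomog_nemf_coeff hp); rewrite /= mdeg_eq0.
Qed.

(** Were y nonzero, q2 would be a multiple of q1, and q1 itself a common factor of positive
    degree. *)
Lemma regular_pair_free k q1 q2 : q1 \is k.+1.-homog -> q2 \is k.+1.-homog ->
  regular_seq [:: q1; q2] -> forall x y, x *: q1 + y *: q2 = 0 -> x = 0 /\ y = 0.
Proof.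
move=> h1 h2 reg x y rel; have q10 := regular_pair_neq0 reg.
have y0 : y = 0.
  apply/eqP; apply: contraT => y0.
  have q2E : q2 = q1 * (- (y^-1 * x))%:MP.
    rewrite mulrC mul_mpolyC scaleNr -scalerA; apply/eqP; rewrite -addr_eq0 addrC.
    by rewrite -[q2 in X in _ + X]scale1r -(mulVf y0) -scalerA -scalerDr rel scaler0.
  have : regular_seq [:: q1 * 1; q1 * (- (y^-1 * x))%:MP] by rewrite mulr1 -q2E.
  by move/regular_pair_coprime; rewrite (dhomog_mcoeff0 h1) eqxx.
move: rel; rewrite y0 scale0r addr0 => /eqP; rewrite scaler_eq0 (negPf q10) orbF.
by move/eqP.
Qed.
End RegularPairs.

(** * Forms whose product with w lies in the ideal of two quadrics *)

Section PlaneComponent.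
Variables (K : numFieldType).
Local Notation S := {mpoly K[4]}.
Local Notation regular_seq := (@regular_seq 4 K).
Local Notation w := ('X_ord_max : S).
Local Notation rho := (@reduce 3 K ord_max w).
Implicit Types (p q f g l : S).

Let hw : w \is 1.-homog := homogXU K ord_max.
Let w1 : w@_U_(ord_max) = 1. Proof. by rewrite mcoeffXU eqxx. Qed.
Let w0 : w != 0. Proof. exact: mcoeff1_neq0 w1. Qed.
Let rhow : rho w = 0. Proof. exact: reduce_var0. Qed.

Lemma rho_split p : exists h, p = rho p + w * h.
Proof. exact: reduceP. Qed.

Lemma rho_id p : rho (rho p) = rho p.
Proof.
have [h pE] := rho_split p.
by rewrite [in RHS]pE reduceD reduceM rhow mul0r addr0.
Qed.

Lemma w_quotient k p : p \is k.+1.-homog -> rho p = 0 -> exists2 l, l \is k.-homog & p = w * l.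
Proof.
move=> hp /reduce_eq0[l pE]; exists (pihomog mdeg k l); first exact: pihomogP.
by rewrite -(pihomog_dE hp) pE (pihomogM _ hw) // subn1.
Qed.

Section Reduction.
Variables (q1 q2 g1 g2 f : S).
Hypotheses (h1 : q1 \is 2.-homog) (h2 : q2 \is 2.-homog).
Hypotheses (ind : forall x y, x *: q1 + y *: q2 = 0 -> x = 0 /\ y = 0).
Hypotheses (cop : forall a b, q1 = w * a -> q2 = w * b -> False).
Hypotheses (fE : w * f = q1 * g1 + q2 * g2).

(** A member of the pencil vanishes on the plane, so it equals w l. Substituting it for q1 leaves q2
    g divisible by w; as w does not divide both quadrics, it divides g, and cancelling w puts f in
    (l, q2). *)
Lemma proportional_reductions x y :
  x != 0 -> x *: rho q1 + y *: rho q2 = 0 -> in_linear_quadric f.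
Proof.
move=> x0 rel; pose q := x *: q1 + y *: q2.
have hq : q \is 2.-homog by rewrite rpredD // rpredZ.
have [|l hl qE] := w_quotient hq; first by rewrite reduceD !reduceZ.
have q1E : q1 = x^-1%:MP * (w * l - y%:MP * q2).
  by rewrite -qE /q !mul_mpolyC addrK scalerA mulVf // scale1r.
pose g := g2 - (x^-1 * y)%:MP * g1.
have wf : w * f = w * (l * (x^-1%:MP * g1)) + q2 * g.
  by rewrite fE q1E /g mpolyCM; ring.
have := congr1 rho wf; rewrite reduceD !reduceM rhow !mul0r add0r => /esym/eqP.
rewrite mulf_eq0 => /orP[]/eqP/reduce_eq0[k kE].
  case: (@cop (x^-1%:MP * (l - y%:MP * k)) k) => //.
  by rewrite q1E kE; ring.
exists l, q2, (x^-1%:MP * g1), k; split=> //.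
  apply: contraNneq x0 => l0; have [] // := ind (x := x) (y := y).
    by rewrite -/q qE l0 mulr0.
  by move=> ->.
by apply: (mulfI w0); rewrite wf kE; ring.
Qed.
End Reduction.

(** Restricted to w = 0, the relation becomes a syzygy of two plane conics. If it is a Koszul
    syzygy, subtracting its lift makes both cofactors divisible by w. If the conics share a line a,
    the syzygy is a multiple h of (-b2, b1), and lifting it produces the third minor with cofactor
    h. Proportional conics lead to a line-and-quadric ideal, which is excluded. *)
Lemma wf_in_two_quadrics (q1 q2 g1 g2 f : S) :
  q1 \is 2.-homog -> q2 \is 2.-homog -> regular_seq [:: q1; q2] ->
  w * f = q1 * g1 + q2 * g2 ->
  ~ in_linear_quadric f -> in_two_quadrics f \/ in_determinantal f.
Proof.
move=> h1 h2 reg fE not_lin; have ind := regular_pair_free h1 h2 reg.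
have cop a b : q1 = w * a -> q2 = w * b -> False.
  move=> q1E q2E; move: reg; rewrite q1E q2E => /regular_pair_coprime.
  by rewrite (dhomog_mcoeff0 hw) eqxx.
have indr x y : x *: rho q1 + y *: rho q2 = 0 -> x = 0 /\ y = 0.
  move=> xy; suff /andP[/eqP -> /eqP ->] : (x == 0) && (y == 0) by [].
  apply: contraT; rewrite negb_and => xy0; case: not_lin.
  case/orP: xy0 => [x0|y0].
    exact: (proportional_reductions h1 h2 ind cop fE x0 xy).
  have ind' a b : a *: q2 + b *: q1 = 0 -> a = 0 /\ b = 0 by rewrite addrC => /ind[].
  have cop' a b : q2 = w * a -> q1 = w * b -> False by move=> qa qb; apply: (cop b a).
  rewrite addrC in fE; rewrite addrC in xy.
  exact: (proportional_reductions h2 h1 ind' cop' fE y0 xy).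
have := congr1 rho fE; rewrite reduceD !reduceM rhow mul0r => /esym rel.
have hr1 : rho q1 \is 2.-homog by apply: dhomog_reduce.
have hr2 : rho q2 \is 2.-homog by apply: dhomog_reduce.
have [k1' q1E'] := rho_split q1; have [k2' q2E'] := rho_split q2.
have [m1 g1E] := rho_split g1; have [m2 g2E] := rho_split g2.
have [[h [r1 r2]]|[x [y [xy /indr[x0 y0]]]]|[a' [b1' [b2' [ha' hb1' hb2' r1 r2]]]]] :=
  quadric_syzygy hr1 hr2 rel; last 2 first.
- by rewrite x0 y0 eqxx in xy.
(* The factors given by [quadric_syzygy] may involve w; as the restricted quadrics are fixed by
   [rho], reducing the factors preserves the factorization. *)
- pose a := rho a'; pose b1 := rho b1'; pose b2 := rho b2'.
  have ha : a \is 1.-homog by apply: dhomog_reduce.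
  have hb1 : b1 \is 1.-homog by apply: dhomog_reduce.
  have hb2 : b2 \is 1.-homog by apply: dhomog_reduce.
  have {}r1 : rho q1 = a * b1 by rewrite -rho_id r1 reduceM.
  have {}r2 : rho q2 = a * b2 by rewrite -rho_id r2 reduceM.
  have hk q : q \is 2.-homog -> exists2 k, k \is 1.-homog & q = rho q + w * k.
    move=> hq; have hr : rho q \is 2.-homog by apply: dhomog_reduce.
    have [||k hk qk] := @w_quotient 1 (q - rho q); first by rewrite rpredB.
      by rewrite -scaleN1r reduceD reduceZ rho_id scaleN1r subrr.
    by exists k => //; rewrite -qk addrC subrK.
  have [c1 hc1 q1E] := hk _ h1; have [c2 hc2 q2E] := hk _ h2.
  have a0 : a != 0.
    apply/eqP => a0; have [] := indr 1 0; first by rewrite r1 a0 mul0r scaler0 scale0r addr0.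
    by move/eqP; rewrite oner_eq0.
  have indb' x y : x *: b1 + y *: b2 = 0 -> x = 0 /\ y = 0.
    by move=> b0; apply: indr; rewrite r1 r2 !scalerAr -mulrDr b0 mulr0.
  have b10 : b1 != 0.
    apply/eqP => b10; have [] := indb' 1 0; first by rewrite b10 scaler0 scale0r addr0.
    by move/eqP; rewrite oner_eq0.
  have {}rel : b1 * rho g1 + b2 * rho g2 = 0.
    apply: (mulfI a0); rewrite mulr0 -rel r1 r2; ring.
  have [|[h b2E]|[h g2b]] := @linear_prime _ _ b1 b2 (rho g2) hb1 b10.
  + exists (- rho g1); apply/eqP; rewrite -subr_eq0 mulrN opprK addrC; exact/eqP.
  + have b2E' : b2 = b1 * pihomog mdeg 0 h by rewrite -[LHS](pihomog_dE hb2) b2E (pihomogM _ hb1).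
    rewrite (dhomog0_const (pihomogP mdeg 0 h)) mulrC mul_mpolyC in b2E'.
    set c := mcoeff _ _ in b2E'; have [] := indb' (- c) 1.
      by rewrite b2E' scale1r scaleNr addNr.
    by move=> _ /eqP; rewrite oner_eq0.
  have g1b : rho g1 = - (b2 * h).
    apply: (mulfI b10); move/eqP: rel; rewrite g2b addr_eq0 => /eqP ->; ring.
  right; exists a, b1, b2, c1, c2, m1, m2, h; split=> //.
    by split; apply: mcoeff_reduce => //; rewrite mnm1E eqxx.
  apply: (mulfI w0); rewrite fE {1}q1E {1}q2E g1E g2E g1b g2b r1 r2; ring.
left; exists q1, q2, (m1 - h * k2'), (m2 + h * k1'); split=> //.
apply: (mulfI w0); rewrite fE g1E g2E r1 r2.
have -> : rho q1 = q1 - w * k1' by rewrite {2}q1E' addrK.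
have -> : rho q2 = q2 - w * k2' by rewrite {2}q2E' addrK.
ring.
Qed.
End PlaneComponent.

(** * The surface *)

Section Generic.
Variables (K : numFieldType) (D : nat).
Hypothesis D5 : (5 <= D)%N.
Local Notation S := {mpoly K[4]}.
Local Notation ix := (ord0 : 'I_4).
Local Notation iy := (@Ordinal 4 1 isT).
Local Notation iz := (@Ordinal 4 2 isT).
Local Notation iw := (ord_max : 'I_4).
Local Notation x := ('X_ix : S).
Local Notation y := ('X_iy : S).
Local Notation w := ('X_iw : S).
Local Notation rho := (@reduce 3 K iw w).
Implicit Types (p q f g l : S).

(* Membership in the monomial ideal (w, x, y^2). *)
Definition tangent_mon (m : 'X_{1..4}) := [|| 0 < m iw, 0 < m ix | 1 < m iy]%N.
Definition tangentT := {u : dmonom 3 D | tangent_mon (mon u)}.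

(** Only z^D and y z^(D-1) lie outside the ideal, and the exponent of y tells them apart. *)
Lemma card_tangentT : ('C(D + 3, D) - 2 <= #|{: tangentT}|)%N.
Proof.
pose A := [pred u : dmonom 3 D | tangent_mon (mon u)].
have -> : #|{: tangentT}| = #|A| by rewrite card_sig; apply: eq_card.
rewrite -(card_dmonom 3 D) -(cardC A) leq_subLR addnC leq_add2r.
rewrite -[X in (_ <= X)%N]card_bool.
pose g (u : dmonom 3 D) := mon u iy == 0%N.
rewrite -(@card_in_imset _ _ g) ?max_card // => u v; rewrite !inE /tangent_mon !negb_or.
rewrite -!leqNgt !leqn0 => /and3P[/eqP uw /eqP ux uy] /and3P[/eqP vw /eqP vx vy] guv.
have yE : mon u iy = mon v iy by move: guv uy vy; rewrite /g; case: (mon u iy) (mon v iy) => [|[|]] [|[|]].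
have sumE (m : dmonom 3 D) : (mon m ix + (mon m iy + (mon m iz + mon m iw)) = D)%N.
  rewrite -[RHS](mdeg_mon m) mdegE !big_ord_recl big_ord0 addn0.
  by congr (_ + (mon m _ + (mon m _ + mon m _)))%N; apply: val_inj.
apply: (@mon_inj 3 D); apply/mnmP => i.
have zE : mon u iz = mon v iz by have := sumE u; have := sumE v; rewrite uw ux vw vx yE; lia.
have [-> | -> | -> | ->] : [\/ i = ix, i = iy, i = iz | i = iw].
  by case: i => [[|[|[|[|//]]]] Hi]; [constructor 1|constructor 2|constructor 3|constructor 4]; apply: val_inj.
- by rewrite ux vx.
- exact: yE.
- exact: zE.
- by rewrite uw vw.
Qed.

Lemma generic_form_exists : exists f : S,
  [/\ f \is D.-homog, forall m, f@_m != 0 -> tangent_mon m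
    & [/\ ~ in_two_quadrics f, ~ in_linear_quadric f & ~ in_determinantal f]].
Proof.
pose col (u : tangentT) := mon (val u).
have t1 := @thin_two_quadrics K _ col D D5 card_tangentT.
have t2 := @thin_linear_quadric K _ col D D5 card_tangentT.
have t3 := @thin_determinantal K _ col D D5 card_tangentT.
have [v vP] := thin_proper (thinU t1 (thinU t2 t3)).
pose f : S := \sum_(u : tangentT) v u *: 'X_[mon (val u)].
have hf : f \is D.-homog by apply: rpred_sum => u _; rewrite rpredZ // homogX_mon.
have vE : has_coords col v f.
  move=> u; rewrite /f raddf_sum (bigD1 u) //= big1 ?addr0 => [|u' ne].
    by rewrite mcoeffZ mcoeffX eqxx mulr1.
  by rewrite mcoeffZ mcoeffX (inj_eq (@mon_inj 3 D)) (inj_eq val_inj) (negPf ne) mulr0.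
exists f; split=> //.
  move=> m; rewrite /f raddf_sum /=; apply: contraR => mt; rewrite big1 // => u _.
  rewrite mcoeffZ mcoeffX; case: eqP => [um|]; last by rewrite mulr0.
  by move: mt; rewrite -um (valP u).
by split=> bad; apply: vP; [left|right; left|right; right]; exists f.
Qed.

End Generic.

(** * The degeneration from F(2,2;3) and the resulting surface *)

Section Closure.
Variables (K : numFieldType) (E : nat).
Local Notation D := E.+2.
Local Notation S := {mpoly K[4]}.
Local Notation ix := (ord0 : 'I_4).
Local Notation iy := (@Ordinal 4 1 isT).
Local Notation iz := (@Ordinal 4 2 isT).
Local Notation iw := (ord_max : 'I_4).
Local Notation x := ('X_ix : S).
Local Notation y := ('X_iy : S).
Local Notation w := ('X_iw : S).
Local Notation rho := (@reduce 3 K iw w).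
Implicit Types (p q f g l : S).

Lemma tangent_decomposition f : f \is D.-homog -> (forall m, f@_m != 0 -> tangent_mon m) ->
  exists a b e, [/\ a \is E.+1.-homog, b \is E.+1.-homog, e \is E.-homog
    & f = w * a + x * b + y ^+ 2 * e].
Proof.
move=> hf ft; rewrite (homog_sum_mon hf).
pose P f := exists a b e, [/\ a \is E.+1.-homog, b \is E.+1.-homog, e \is E.-homog
    & f = w * a + x * b + y ^+ 2 * e].
apply: (big_ind P).
- by exists 0, 0, 0; rewrite !rpred0 !mulr0 !addr0.
- move=> p q [a [b [e [ha hb he ->]]]] [a' [b' [e' [ha' hb' he' ->]]]].
  by exists (a + a'), (b + b'), (e + e'); rewrite !rpredD //; split=> //; ring.
move=> u _; have [->|/ft] := eqVneq (f@_(mon u)) 0.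
  by exists 0, 0, 0; rewrite !rpred0 !mulr0 !addr0 scale0r.
set c := mcoeff _ _; have um := mdeg_mon u.
have hX (m : 'X_{1..4}) k : mdeg m = k -> (c *: 'X_[m] : S) \is k.-homog.
  by move=> mk; rewrite rpredZ // dhomogX; apply/eqP.
have quot i : (0 < mon u i)%N -> 'X_[mon u] = 'X_i * 'X_[mon u - U_(i)] :> S.
  by move=> ui; rewrite -mpolyXD addmC submK // lep1mP -lt0n.
have quotd (m : 'X_{1..4}) i : (0 < m i)%N -> mdeg (m - U_(i)) = (mdeg m).-1.
  move=> mi; have le : (U_(i) <= m)%MM by rewrite lep1mP -lt0n.
  by rewrite -{2}(submK le) mdegD mdeg1 addn1.
case/or3P=> mi.
- exists (c *: 'X_[mon u - U_(iw)]), 0, 0; rewrite !rpred0 !mulr0 !addr0 (quot iw mi).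
  by rewrite hX ?quotd ?um // scalerAr.
- exists 0, (c *: 'X_[mon u - U_(ix)]), 0; rewrite !rpred0 !mulr0 addr0 add0r (quot ix mi).
  by rewrite hX ?quotd ?um // scalerAr.
- have mi' : (0 < mon u iy)%N by apply: ltnW.
  have mi2 : (0 < (mon u - U_(iy))%MM iy)%N by rewrite mnmBE mnm1E eqxx subn_gt0.
  exists 0, 0, (c *: 'X_[mon u - U_(iy) - U_(iy)]); rewrite !rpred0 !mulr0 !add0r.
  rewrite hX ?quotd ?um //; split=> //; rewrite (quot iy mi') expr2 -mulrA -scalerAr -scalerAr.
  congr (_ *: (_ * _)); rewrite -mpolyXD addmC submK // lep1mP -lt0n //.
Qed.

(** Modulo w the second quadric is t y^2, which is nonzero, so a factor w can be moved across the
    relation twice. *)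
Lemma regular_tangent_pair t : t != 0 -> @regular_seq 4 K [:: w ^+ 2; w * x + t *: y ^+ 2].
Proof.
move=> t0; have w0 : w != 0 by rewrite (@mcoeff1_neq0 _ _ U_(iw)) // mcoeffXU eqxx.
have hw := homogXU K iw.
have hq : w * x + t *: y ^+ 2 \is 2.-homog.
  by rewrite rpredD ?rpredZ ?expr2 // -[2%N]/(1 + 1)%N dhomogM // homogXU.
apply: regular_pairP; rewrite ?(dhomog_mcoeff0 hq) ?expf_neq0 //.
  by apply: (@dhomog_mcoeff0 3 K 1); rewrite expr2 -[2%N]/(1 + 1)%N dhomogM.
have divw g h : (w * x + t *: y ^+ 2) * g = w * h -> exists k, g = w * k.
  move/(congr1 rho); rewrite !reduceM reduceD reduceM reduceZ reduce_var0 !mul0r add0r expr2 reduceM.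
  rewrite reduceX /= => /eqP; rewrite mulf_eq0 scaler_eq0 (negPf t0) /= mulf_eq0 orbb.
  have -> /= : (y == 0) = false by apply/negbTE; rewrite (@mcoeff1_neq0 _ _ U_(iy)) // mcoeffXU eqxx.
  by move/eqP/reduce_eq0.
move=> g h gh; have [|k gk] := divw g (w * h); first by rewrite gh; ring.
have [|k' kk] := divw k h; first by apply: (mulfI w0); rewrite mulrCA -gk gh; ring.
by exists k'; rewrite gk kk; ring.
Qed.

Lemma regular_plane_quartic : @regular_seq 4 K [:: w; y ^+ 4].
Proof.
have w0 : w != 0 by rewrite (@mcoeff1_neq0 _ _ U_(iw)) // mcoeffXU eqxx.
have hy : y ^+ 4 \is 4.-homog by have := dhomogMn 4 (homogXU K iy); rewrite mul1n.
apply: regular_pairP => //; first exact: dhomog_mcoeff0 (homogXU K iw).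
  exact: dhomog_mcoeff0 hy.
move=> g h /(congr1 rho); rewrite reduceM [RHS]reduceM reduce_var0 mulr0 => /eqP.
have -> : rho (y ^+ 4) = y ^+ 4 by rewrite !exprS expr0 mulr1 !reduceM reduceX.
rewrite mulf_eq0 expf_eq0 /=.
have -> /= : (y == 0) = false by apply/negbTE; rewrite (@mcoeff1_neq0 _ _ U_(iy)) // mcoeffXU eqxx.
by move/eqP/reduce_eq0 => -[k ->]; exists k; rewrite mulrC.
Qed.

Lemma Fset_pair k1 k2 q1 q2 g1 g2 f : f != 0 -> f \is D.+1.-homog ->
  q1 \is k1.-homog -> q2 \is k2.-homog -> g1 \is (D.+1 - k1)%N.-homog -> g2 \is (D.+1 - k2)%N.-homog ->
  f = q1 * g1 + q2 * g2 -> @regular_seq 4 K [:: q1; q2] -> @Fset K 3 D.+1 [:: k1; k2] f.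
Proof.
move=> f0 hf h1 h2 hg1 hg2 fE reg; split=> //; split=> //.
exists [:: q1; q2], [:: g1; g2]; split=> //; first by case=> [|[|//]].
by rewrite !big_ord_recl big_ord0 addr0.
Qed.

Lemma horner_mmap N (h : 'I_N -> {poly K}) (G : {mpoly K[N]}) t :
  (mmap polyC h G).[t] = G.@[fun i => (h i).[t]].
Proof.
rewrite /mmap horner_sum mevalE; apply: eq_bigr => m _.
rewrite hornerM hornerC /mmap1 horner_prod; congr (_ * _).
by apply: eq_bigr => i _; rewrite horner_exp.
Qed.

Lemma closure_plane_surface f : f != 0 -> f \is D.-homog -> (forall m, f@_m != 0 -> tangent_mon m) ->
  @zariski_closure K 3 D.+1 (@Fset K 3 D.+1 [:: 2%N; 2%N]) (w * f).
Proof.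
move=> f0 hf ft; have w0 : w != 0 by rewrite (@mcoeff1_neq0 _ _ U_(iw)) // mcoeffXU eqxx.
have hwf : w * f \is D.+1.-homog := dhomogM (homogXU K iw) hf.
split; first by rewrite mulf_neq0.
split=> // k G _ G0; have [a [b [e [ha hb he fE]]]] := tangent_decomposition hf ft.
have hy2 : y ^+ 2 \is 2.-homog by have := dhomogMn 2 (homogXU K iy); rewrite mul1n.
pose r := y ^+ 2 * b.
have hr : r \is D.+1.-homog := dhomogM hy2 hb.
have hxe i : 'X_i * e \is E.+1.-homog := dhomogM (homogXU K i) he.
have inF t : t != 0 -> w * f + t *: r != 0 -> @Fset K 3 D.+1 [:: 2%N; 2%N] (w * f + t *: r).
  (* The cofactors come from t y^2 = (w x + t y^2) - w x, which rewrites w y^2 e as t^-1 w e (w x +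
     t y^2) - t^-1 x e w^2. *)
  move=> t0 ft0; apply: (@Fset_pair 2 2 (w ^+ 2) (w * x + t *: y ^+ 2)
    (a - t^-1 *: (x * e)) (b + t^-1 *: (w * e))) => //.
  - by rewrite rpredD // rpredZ.
  - by have := dhomogMn 2 (homogXU K iw); rewrite mul1n.
  - by rewrite rpredD ?rpredZ // -[2%N]/(1 + 1)%N dhomogM // homogXU.
  - exact: rpredB ha (rpredZ _ (hxe ix)).
  - exact: rpredD hb (rpredZ _ (hxe iw)).
  - have tt : t%:MP * t^-1%:MP = 1 :> S by rewrite -mpolyCM mulfV.
    rewrite -!mul_mpolyC fE /r.
    transitivity (w ^+ 2 * a + (w * x + t%:MP * y ^+ 2) * b + t%:MP * t^-1%:MP * (y ^+ 2 * w * e)).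
      by rewrite tt; ring.
    by ring.
  - exact: regular_tangent_pair.
(* The one value of t at which the form w f + t r might vanish and so represent no point. If r = 0,
   the form is w f for every t and the default 0 is harmless. *)
pose t0 : K := if [pick u : dmonom 3 D.+1 | r@_(mon u) != 0] is Some u
  then - (w * f)@_(mon u) / r@_(mon u) else 0.
have ft_neq0 t : t != t0 -> w * f + t *: r != 0.
  rewrite /t0; case: pickP => [u ru|r0] tt0.
    apply: contraNneq tt0 => /(congr1 (mcoeff (mon u)))/eqP.
    rewrite mcoeff0 mcoeffD mcoeffZ addrC addr_eq0 => /eqP trE.
    by rewrite -trE mulfK.
  have -> : r = 0.
    rewrite (homog_sum_mon hr) big1 // => u _; have := r0 u => /negbFE/eqP ->.
    by rewrite scale0r.
  by rewrite scaler0 addr0 mulf_neq0.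
pose P := mmap polyC (fun i => (coords 3 D.+1 (w * f) i)%:P + (coords 3 D.+1 r i)%:P * 'X) G.
have PE t : P.[t] = G.@[coords 3 D.+1 (w * f + t *: r)].
  rewrite horner_mmap; apply: meval_eq => i.
  by rewrite !hornerE /coords mcoeffD mcoeffZ [X in _ + X]mulrC.
have P0 : P = 0.
  (* The extra factor kills the two excluded parameters 0 and [t0], so the product vanishes at every
     t and is zero; hence [P] is zero, in particular at t = 0. *)
  have : P * ('X * ('X - t0%:P)) = 0.
    apply/eqP; apply: contraT => /poly_nonroot[t].
    rewrite !hornerM hornerX hornerXsubC !mulf_eq0 !negb_or subr_eq0 PE => /and3P[/eqP Pt t00 tt0].
    by case: Pt; apply: G0; apply: inF => //; apply: ft_neq0.
  move/eqP; rewrite !mulf_eq0 polyX_eq0 polyXsubC_eq0 !orbF => /eqP //.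
by rewrite -[RHS](horner0 0) -P0 PE scale0r addr0.
Qed.

Theorem plane_surface_exists : (5 <= D)%N ->
  exists f : S,
    [/\ @zariski_closure K 3 D.+1 (@Fset K 3 D.+1 [:: 2%N; 2%N]) f,
        ~ @Fset K 3 D.+1 [:: 2%N; 2%N] f
      & @Fset K 3 D.+1 [:: 1%N; 4%N] f].
Proof.
move=> D5; have [f [hf ft [nb1 nb2 nb3]]] := generic_form_exists K D5.
have f0 : f != 0.
  apply/eqP => f0; apply: nb2; exists x, (y ^+ 2), 0, 0.
  rewrite !mulr0 addr0 f0 homogXU; split=> //.
    by rewrite (@mcoeff1_neq0 _ _ U_(ix)) // mcoeffXU eqxx.
  by have := dhomogMn 2 (homogXU K iy); rewrite mul1n.
have w0 : w != 0 by rewrite (@mcoeff1_neq0 _ _ U_(iw)) // mcoeffXU eqxx.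
have hwf : w * f \is D.+1.-homog := dhomogM (homogXU K iw) hf.
exists (w * f); split; first exact: closure_plane_surface.
- case=> _ [_ [[|q1 [|q2 [|? ?]]] [[|g1 [|g2 [|? ?]]] []]]] //= _ _ hq.
  rewrite !big_ord_recl big_ord0 addr0 /= => fE reg.
  have [h1 _] := hq 0%N isT; have [h2 _] := hq 1%N isT.
  by have [] := wf_in_two_quadrics h1 h2 reg fE nb2.
- apply: (@Fset_pair 1 4 w (y ^+ 4) f 0) => //.
  + by rewrite mulf_neq0.
  + exact: homogXU.
  + by have := dhomogMn 4 (homogXU K iy); rewrite mul1n.
  + exact: rpred0.
  + by rewrite mulr0 addr0.
  + exact: regular_plane_quartic.
Qed.
End Closure.

Theorem theorem6p7 (R : realType) (d : nat) : (6 <= d)%N ->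
  exists f : {mpoly (complex R)[4]},
    [/\ zariski_closure 3 d (Fset 3 d [:: 2%N; 2%N]) f,
        ~ Fset 3 d [:: 2%N; 2%N] f
      & Fset 3 d [:: 1%N; 4%N] f].
Proof.
case: d => // -[|[|E]] // D5; exact: (@plane_surface_exists (complex R) E D5).
Qed.
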